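(* There is an absolute constant $A>0$ such that the following holds. Suppose $0<\varepsilon<1/2$ and $0<b<\frac12\sqrt{\varepsilon}$. There is a positive constant $\lambda$, depending only on $\varepsilon$ and $b$, such that for every real $N\ge100$ and every real $s\ge1$ with $s\le\exp\left(b\sqrt{\log N\,\log\log N}\right)$, setting \[ K=L(N,s)^{(1/2-\varepsilon)/s}, \] every residue system $C$ with $S(C)$ consisting of integers from $(N,KN]$, each with multiplicity at most $s$, satisfies \[ \delta(C)\ge\left(1-\frac{A}{(\log N)^{\lambda}}\right)\alpha(C). \]
   Context: A residue system is a finite set $C$ of ordered pairs of positive integers $(n,r)$, each interpreted as the residue class $r\pmod n$. $S(C)$ is the multiset of the moduli $n$ appearing in $C$ (with $n$ repeated once for each pair $(n,r)\in C$); the multiplicity of $n$ is the number of times it appears in $S(C)$. $R(C)$ is the set of integers not congruent to $r\pmod n$ for any $(n,r)\in C$, and $\delta(C)$ is the asymptotic density of $R(C)$ (which exists, since $R(C)$ is a union of residue classes modulo the least common multiple of the moduli). Also $\alpha(C)=\prod_{n\in S(C)}(1-1/n)$, the product taken with multiplicity, and \[ L(N,s)=\exp\left(\log N\,\frac{\log\log(s\log N)}{\log(s\log N)}\right). \] *)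

(* Defs.v *)
From mathcomp Require Export all_boot all_order all_algebra finmap multiset.
From mathcomp Require Export all_classical all_reals all_analysis.

Set Implicit Arguments.
Unset Strict Implicit.
Unset Printing Implicit Defensive.

Import Order.TTheory GRing.Theory Num.Theory.
Import numFieldNormedType.Exports.

Local Open Scope classical_set_scope.
Local Open Scope ring_scope.

(* A pair (n, r) stands for the residue class of r modulo n. Distinct pairs
   such as (n, r) and (n, r + n) denote the same class but are distinct
   elements of C, and are counted separately in [moduli C] and [alpha C]. *)
Definition residue_system (C : {fset nat * nat}) : Prop :=
  forall n r : nat, (n, r) \in C -> (0 < n)%N /\ (0 < r)%N.

Definition moduli (C : {fset nat * nat}) : {mset nat}%mset :=
  seq_mset [seq c.1 | c <- C].

Definition uncovered (C : {fset nat * nat}) : set int :=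
  [set m : int | forall n r : nat, (n, r) \in C ->
     (m != r%:Z %[mod n%:Z])%Z].

(* [lim] is total, with a junk value when there is no limit. It is only used
   below on sets that are unions of classes modulo a positive integer, for which
   the limit exists and does not change if one counts over [-n, n] instead. *)
Definition density (R : realType) (E : set int) : R :=
  lim ((fun n : nat =>
    (count (fun m : nat => m%:Z \in E) (iota 1 n))%:R / n%:R : R) @ \oo).

Definition delta (R : realType) (C : {fset nat * nat}) : R :=
  density R (uncovered C).

(* The big product runs over the enumeration of the multiset, in which each
   modulus is repeated according to its multiplicity. *)
Definition alpha (R : realType) (C : {fset nat * nat}) : R :=
  \prod_(n <- moduli C) (1 - n%:R^-1).

Definition L (R : realType) (N s : R) : R :=
  expR (ln N * (ln (ln (s * ln N)) / ln (s * ln N))).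

(* Main.v *)
(* The classes are fibred over the residue h modulo the Q-smooth part M of a common
   period, with Q = L(N, s)^(1/2 - e) and e slightly smaller than eps.  On each
   fibre the remaining moduli have all their prime factors larger than Q, hence
   are nearly pairwise coprime, and a one-step induction (avoids_ge) bounds the
   uncovered proportion below by the product of the (1 - 1/n), up to a sum over
   pairs with a common factor.  Averaged over h, the products are at least about
   alpha(C) by convexity of exp (avoids_ge_smooth), provided that the Q-smooth
   moduli have small total density; the pairs contribute at most
   (1/Q) sum gcd(n, n') / (n n'), which is negligible against alpha(C), a quantity
   of order at least L(N, s)^-(1/2 - eps).  Rankin's trick bounds the density of
   the smooth moduli: smooth_part^sigma is summed over a multiplicative interval
   ]x, K x] uniformly in x, by induction on the primes (S_step), so that no
   estimate for the product of the (1 - 1/p) is needed. *)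
Require Import Defs.
From mathcomp Require Import ring lra zify.
Import Order.TTheory GRing.Theory Num.Theory.
Import numFieldNormedType.Exports.
Local Open Scope ring_scope.

Set Implicit Arguments.
Unset Strict Implicit.
Unset Printing Implicit Defensive.

(** * Averages over a period *)

Section Counting.
Variable R : realType.
Implicit Types (F G : nat -> R) (P Q : nat -> bool) (c : nat * nat).

Definition mean (T : nat) F : R := (\sum_(x < T) F x) / T%:R.

Lemma eq_mean T F G : F =1 G -> mean T F = mean T G.
Proof. by move=> FG; rewrite /mean (eq_bigr (fun x : 'I_T => G x)). Qed.

Lemma le_mean T F G : (forall x, F x <= G x) -> mean T F <= mean T G.
Proof.
by move=> FG; rewrite ler_wpM2r ?invr_ge0 ?ler0n// ler_sum.
Qed.

Lemma meanD T F G : mean T (fun x => F x + G x) = mean T F + mean T G.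
Proof. by rewrite /mean big_split mulrDl. Qed.

Lemma meanZ T (a : R) F : mean T (fun x => a * F x) = a * mean T F.
Proof. by rewrite /mean -mulr_sumr mulrA. Qed.

Lemma mean_sum T (I : Type) (s : seq I) (p : pred I) (F : I -> nat -> R) :
  mean T (fun x => \sum_(i <- s | p i) F i x) = \sum_(i <- s | p i) mean T (F i).
Proof. by rewrite /mean exchange_big -mulr_suml. Qed.

Lemma mean_const T (a : R) : (0 < T)%N -> mean T (fun=> a) = a.
Proof.
move=> T0; rewrite /mean sumr_const card_ord -[a *+ T]mulr_natr mulfK//.
by rewrite pnatr_eq0 -lt0n.
Qed.

Lemma mean_ge0 T F : (forall x, 0 <= F x) -> 0 <= mean T F.
Proof. by move=> F0; rewrite divr_ge0 ?ler0n// sumr_ge0. Qed.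

(** The Chinese remainder theorem: the map to pairs of residues is injective between finite sets of
    equal size, so the sum can be reindexed. *)
Lemma mean_crt (a b : nat) (F : nat -> nat -> R) :
  (0 < a)%N -> (0 < b)%N -> coprime a b ->
  mean (a * b) (fun x => F (x %% a)%N (x %% b)%N) =
  mean a (fun h => mean b (F h)).
Proof.
move=> a0 b0 cab.
rewrite /mean -mulr_suml natrM invfM -mulrA [b%:R^-1 * _]mulrC; congr (_ * _).
rewrite pair_big /=.
pose f (x : 'I_(a * b)) : 'I_a * 'I_b :=
  (Ordinal (ltn_pmod x a0), Ordinal (ltn_pmod x b0)).
rewrite (reindex f) //; apply: onW_bij.
apply: inj_card_bij; last by rewrite card_prod !card_ord.
move=> x y [] /eqP xa /eqP xb; apply/val_inj => /=.
have /eqP : (x == y %[mod a * b])%N by rewrite chinese_remainder// xa xb.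
by rewrite !modn_small.
Qed.

Lemma mean_periodic (k T : nat) F : (0 < k)%N -> (0 < T)%N ->
  (forall x, F (x + T)%N = F x) -> mean (k * T) F = mean T F.
Proof.
move=> k0 T0 FT.
suff -> : mean (k * T) F = k%:R * (\sum_(x < T) F x) / (k * T)%:R.
  rewrite /mean natrM invfM; field; rewrite !pnatr_eq0; lia.
congr (_ / _); rewrite -[LHS](big_mkord xpredT).
elim: k {k0} => [|k IH]; first by rewrite mul0n big_geq// mul0r.
rewrite mulSn addnC (big_cat_nat _ (n := k * T))//= ?leq_addr// IH.
rewrite -[X in \sum_(X <= _ < _) _](add0n (k * T)%N).
rewrite [X in _ + X](_ : _ = \sum_(x < T) F x); first by rewrite -natr1 mulrDl mul1r.
rewrite big_addn addKn -(big_mkord xpredT); apply: eq_bigr => i _.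
elim: k {IH} => [|k IH]; first by rewrite addn0.
by rewrite mulSn addnCA addnC FT.
Qed.

Lemma mean_class (T n r : nat) : (0 < T)%N -> (n %| T)%N ->
  mean T (fun x => (x == r %[mod n])%:R) = n%:R^-1.
Proof.
move=> T0 /dvdnP[k Tk]; rewrite Tk in T0 *.
have [k0 n0] : (0 < k)%N /\ (0 < n)%N by apply/andP; rewrite -muln_gt0.
rewrite mean_periodic// => [|x]; last by rewrite modnDr.
rewrite /mean (bigD1 (Ordinal (ltn_pmod r n0)))//= modn_mod eqxx.
rewrite big1 ?addr0 ?mul1r// => i ni.
rewrite modn_small//; case: eqP => // E; case/negP: ni; apply/eqP/val_inj.
exact: E.
Qed.
End Counting.

(** * Avoiding residue classes *)

Section Sieve.
Variable R : realType.
Implicit Types (F G : nat -> R) (P Q : nat -> bool) (c d : nat * nat)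
  (C D : seq (nat * nat)) (T : nat).

Lemma mean_indep (a b : nat) P Q :
  (0 < a)%N -> (0 < b)%N -> coprime a b ->
  (forall x, P (x %% a)%N = P x) -> (forall x, Q (x %% b)%N = Q x) ->
  mean (a * b) (fun x => (P x && Q x)%:R : R) =
  mean (a * b) (fun x => (P x)%:R) * mean (a * b) (fun x => (Q x)%:R).
Proof.
move=> a0 b0 cab Pa Qb.
have -> : mean (a * b) (fun x => (P x)%:R) = mean a (fun x => (P x)%:R) :> R.
  rewrite mulnC mean_periodic// => x.
  by rewrite -Pa modnDr Pa.
have -> : mean (a * b) (fun x => (Q x)%:R) = mean b (fun x => (Q x)%:R) :> R.
  rewrite mean_periodic// => x.
  by rewrite -Qb modnDr Qb.
rewrite (eq_mean _ (G := fun x => (P (x %% a)%N && Q (x %% b)%N)%:R)); last first.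
  by move=> x; rewrite Pa Qb.
rewrite (mean_crt (fun h t => (P h && Q t)%:R))//.
rewrite mulrC -meanZ; apply: eq_mean => h.
rewrite mulrC -meanZ; apply: eq_mean => t.
by rewrite -mulnb natrM.
Qed.

Definition hits c : pred nat := fun x => x == c.2 %[mod c.1].

Definition avoids C : pred nat := fun x => all (fun c => ~~ hits c x) C.

Definition common_multiple T C := all (fun c => c.1 %| T)%N C.

Lemma hits_modn T c x : (c.1 %| T)%N -> hits c (x %% T)%N = hits c x.
Proof. by move=> cT; rewrite /hits modn_dvdm. Qed.

Lemma avoids_modn T C x : common_multiple T C -> avoids C (x %% T)%N = avoids C x.
Proof.
by move=> /allP CT; apply: eq_in_all => c cC; rewrite hits_modn// CT.
Qed.

Lemma mean_hits T c : (0 < T)%N -> (c.1 %| T)%N ->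
  mean T (fun x => (hits c x)%:R) = c.1%:R^-1 :> R.
Proof. exact: mean_class. Qed.

Definition density_product C : R := \prod_(c <- C) (1 - c.1%:R^-1).

(* Includes the diagonal and counts every pair twice. *)
Definition correlation C : R :=
  \sum_(c <- C) \sum_(d <- C | (1 < gcdn c.1 d.1)%N) (c.1%:R^-1 * d.1%:R^-1).

(* Classes with modulus coprime to that of [c] are independent of [c]; the
   others are discarded at the cost of their total density. *)
Lemma mean_hits_avoids T c C : (0 < T)%N -> (c.1 %| T)%N -> common_multiple T C ->
  mean T (fun x => (hits c x && avoids C x)%:R) <=
  c.1%:R^-1 * (mean T (fun x => (avoids C x)%:R) +
    \sum_(d <- C | (1 < gcdn c.1 d.1)%N) d.1%:R^-1) :> R.
Proof.
move=> T0 cT CT; have c0 : (0 < c.1)%N := dvdn_gt0 T0 cT.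
pose D := [seq d <- C | coprime c.1 d.1].
(* Split [T] by the primes of [c.1]: the class [c] depends on one part and the classes of [D] on the
   other, so they are independent. *)
pose pi : nat_pred := \pi(c.1).
have Tpi : T = (T`_pi * T`_pi^')%N by rewrite partnC.
have cTpi : (c.1 %| T`_pi)%N.
  by rewrite -(part_pnat_id (pnat_pi c0)) partn_dvd.
have DTpi : common_multiple T`_pi^' D.
  apply/allP => d; rewrite mem_filter => /andP[cd dC].
  have dT : (d.1 %| T)%N by apply: (allP CT).
  have d0 := dvdn_gt0 T0 dT.
  rewrite -(@part_pnat_id pi^' d.1) ?partn_dvd//.
  by rewrite -coprime_pi'.
have indep : mean T (fun x => (hits c x && avoids D x)%:R) =
    c.1%:R^-1 * mean T (fun x => (avoids D x)%:R) :> R.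
  rewrite -(mean_hits T0 cT) Tpi mean_indep ?part_gt0 ?coprime_partC//.
  - by move=> x; rewrite hits_modn.
  - by move=> x; rewrite avoids_modn.
apply: (@le_trans _ _ (mean T (fun x => (hits c x && avoids D x)%:R))).
  apply: le_mean => x; rewrite ler_nat.
  case: (hits c x) => //; case: (boolP (avoids C x)) => //= /allP aC.
  suff -> : avoids D x by [].
  by apply/allP => d; rewrite mem_filter => /andP[_ /aC].
rewrite indep ler_wpM2l ?invr_ge0 ?ler0n//.
rewrite (_ : \sum_(d <- C | _) _ =
    mean T (fun x => \sum_(d <- C | (1 < gcdn c.1 d.1)%N) (hits d x)%:R)); last first.
  rewrite mean_sum big_seq_cond [RHS]big_seq_cond; apply: eq_bigr => d /andP[dC _].
  by rewrite mean_hits//; apply: (allP CT).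
rewrite -meanD; apply: le_mean => x.
have [aC|naC] := boolP (avoids C x).
  by case: (avoids D x); rewrite ?lerDl ?addr_ge0 ?sumr_ge0.
have [aD|] := boolP (avoids D x); last by rewrite add0r sumr_ge0.
(* A point that avoids [D] but not [C] hits a class sharing a factor with [c], which the sum
   counts. *)
move: naC; rewrite -has_predC => /hasP[d dC]; rewrite /= negbK => hd.
rewrite add0r.
have cd : (1 < gcdn c.1 d.1)%N.
  rewrite ltn_neqAle gcdn_gt0 c0 /= andbT eq_sym; apply/negP => cd.
  have /(allP aD) : d \in D by rewrite mem_filter dC /coprime cd.
  by rewrite hd.
rewrite (big_rem d dC)/= cd hd lerDl sumr_ge0//.
Qed.

(** Induction on the list: adding [c] removes at most the proportion given by [mean_hits_avoids].
    Its main term yields the factor [1 - 1 / c.1], and its error is charged to the row of [c] in the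
    correlation. *)
Lemma avoids_ge T C : (0 < T)%N -> common_multiple T C ->
  density_product C - correlation C <= mean T (fun x => (avoids C x)%:R).
Proof.
move=> T0; elim: C => [_|c C IH /= /andP[cT CT]].
  by rewrite /density_product /correlation !big_nil subr0 mean_const.
have {}IH := IH CT; have c0 := dvdn_gt0 T0 cT.
have hc := mean_hits_avoids T0 cT CT.
have -> : mean T (fun x => (avoids (c :: C) x)%:R) =
   mean T (fun x => (avoids C x)%:R) -
   mean T (fun x => (hits c x && avoids C x)%:R) :> R.
  apply/eqP; rewrite eq_sym subr_eq -meanD; apply/eqP; apply: eq_mean => x /=.
  by case: (hits c x) (avoids C x) => -[]; rewrite ?addr0 ?add0r.
set m := mean _ _ in IH hc *; set m' := mean _ _ in hc *.
have -> : density_product (c :: C) = (1 - c.1%:R^-1) * density_product C.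
  by rewrite /density_product big_cons.
have : correlation C + c.1%:R^-1 * \sum_(d <- C | (1 < gcdn c.1 d.1)%N) d.1%:R^-1
    <= correlation (c :: C).
  rewrite /correlation big_cons addrC lerD//.
    rewrite big_cons mulr_sumr.
    case: ifP => _ //.
    by rewrite lerDr mulr_ge0 ?invr_ge0 ?ler0n.
  rewrite ler_sum// => d _; rewrite big_cons.
  by case: ifP => _ //; rewrite lerDr mulr_ge0 ?invr_ge0 ?ler0n.
set s := \sum_(d <- C | _) _ in hc *.
have x0 : 0 <= c.1%:R^-1 :> R by rewrite invr_ge0 ler0n.
have x1 : c.1%:R^-1 <= 1 :> R by rewrite invf_le1 ?ltr0n// ler1n.
move=> hcor.
have cor0 : 0 <= correlation C.
  by rewrite /correlation sumr_ge0// => d _; rewrite sumr_ge0// => e _;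
     rewrite mulr_ge0// invr_ge0 ler0n.
have : (1 - c.1%:R^-1) * (density_product C - correlation C) <= (1 - c.1%:R^-1) * m.
  by rewrite ler_wpM2l// subr_ge0.
have : 0 <= c.1%:R^-1 * correlation C by rewrite mulr_ge0.
move: hc; rewrite mulrDr mulrBr !mulrBl !mul1r.
lra.
Qed.
End Sieve.

(** * Fibres over the smooth part *)

Section SmoothPart.
Variable R : realType.
Implicit Types (c d : nat * nat) (C D : seq (nat * nat)) (T : nat).

(** From [1 / (1 - x) = 1 + x / (1 - x) <= exp (x / (1 - x))] and [1 / (1 - x) <= 1 + 2 y]. *)
Lemma expR_le_1B (x y : R) : 0 <= x -> x <= y -> y <= 1 / 2 ->
  expR (- ((1 + 2 * y) * x)) <= 1 - x.
Proof.
move=> x0 xy y2; have x1 : 0 < 1 - x by lra.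
rewrite expRN -[leRHS]invrK lef_pV2 ?posrE ?invr_gt0 ?expR_gt0//.
have -> : (1 - x)^-1 = 1 + x / (1 - x) by field; lra.
apply: le_trans (expR_ge1Dx _) _; rewrite ler_expR ler_pdivrMr//.
nra.
Qed.

Lemma density_product_ge (Q : R) C : 2 <= Q -> {in C, forall c, Q <= c.1%:R} ->
  expR (- ((1 + 2 / Q) * \sum_(c <- C) c.1%:R^-1)) <= density_product R C.
Proof.
move=> Q2; have Q0 : 0 < Q by lra.
rewrite /density_product; elim: C => [|c C IH] CQ.
  by rewrite !big_nil mulr0 oppr0 expR0.
rewrite !big_cons mulrDr opprD expRD ler_pM ?expR_ge0//.
  apply: expR_le_1B; rewrite ?invr_ge0 ?ler0n//.
    rewrite lef_pV2 ?posrE//; first by rewrite CQ ?mem_head.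
    by apply: lt_le_trans Q0 _; rewrite CQ ?mem_head.
  by rewrite mul1r lef_pV2 ?posrE.
by apply: IH => d dC; apply: CQ; rewrite inE dC orbT.
Qed.

Lemma density_product_ge0 C : {in C, forall c, (0 < c.1)%N} ->
  0 <= density_product R C.
Proof.
move=> C0; rewrite /density_product big_seq prodr_ge0// => c /C0 c0.
by rewrite subr_ge0 invf_le1 ?ltr0n// ler1n.
Qed.

(** Two classes are either disjoint or meet in a single class modulo the lcm of their moduli. *)
Lemma mean_hits2 T c d : (0 < T)%N -> (c.1 %| T)%N -> (d.1 %| T)%N ->
  mean T (fun x => (hits c x && hits d x)%:R) <= (lcmn c.1 d.1)%:R^-1 :> R.
Proof.
move=> T0 cT dT.
have [[y /andP[cy dy]]|none] := pselect (exists y, hits c y && hits d y).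
  rewrite -(@mean_class R T (lcmn c.1 d.1) y)// ?dvdn_lcm ?cT//.
  apply: le_mean => x.
  case: (boolP (hits c x && hits d x)) => // /andP[cx dx].
  suff -> : (x == y %[mod lcmn c.1 d.1])%N by [].
  wlog xy : x y cx dx cy dy / (y <= x)%N.
    move=> H; case: (leqP y x) => [|/ltnW] xy; first exact: H.
    by rewrite eq_sym; apply: H.
  rewrite eqn_mod_dvd// dvdn_lcm -!eqn_mod_dvd//.
  move: cx cy dx dy; rewrite /hits => /eqP -> /eqP -> /eqP -> /eqP ->.
  by rewrite !eqxx.
apply: (@le_trans _ _ (mean T (fun=> 0))).
  apply: le_mean => x; case: (boolP (_ && _)) => // cd.
  by case: none; exists x.
by rewrite mean_const// invr_ge0 ler0n.
Qed.

(** In the application [pi] is the set of primes up to [Q]. *)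
Variables (pi : nat_pred) (Q : R).
Hypothesis Q2 : 2 <= Q.
Hypothesis rough : forall p, prime p -> p \notin pi -> Q <= p%:R.

Let Q_gt0 : 0 < Q. Proof. exact: lt_le_trans Q2. Qed.

Lemma rough_ge (n : nat) : pi^'.-nat n -> (1 < n)%N -> Q <= n%:R.
Proof.
move=> pin n1; have pp := pdiv_prime n1.
apply: (@le_trans _ _ (pdiv n)%:R); last by rewrite ler_nat pdiv_leq// ltnW.
apply: rough => //; apply: (pnatPpi pin); rewrite mem_primes pp pdiv_dvd.
by rewrite andbT/= ltnW.
Qed.

(** What [C] becomes on the class of [h] modulo the [pi]-part of the period: a class either misses
    this fibre or is cut out by the complementary part of its modulus. If the modulus is a
    [pi]-number, that part is 1 and the class covers every fibre it meets. *)
Definition fiber C (h : nat) : seq (nat * nat) :=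
  [seq (c.1`_pi^', c.2)%N | c <- C & hits (c.1`_pi, c.2)%N h].

Lemma hits_part c x : (0 < c.1)%N ->
  hits c x = hits (c.1`_pi, c.2)%N x && hits (c.1`_pi^', c.2)%N x.
Proof.
by move=> c0; rewrite /hits -{1 2}(partnC pi c0) chinese_remainder ?coprime_partC.
Qed.

Lemma mean_fiber T C : (0 < T)%N -> common_multiple T C ->
  mean T (fun x => (avoids C x)%:R) =
  mean T`_pi (fun h => mean T`_pi^' (fun t => (avoids (fiber C h) t)%:R)) :> R.
Proof.
move=> T0 CT; rewrite -(mean_crt _ (part_gt0 _ _) (part_gt0 _ _))
  ?coprime_partC// partnC//.
apply: eq_mean => x; congr (_%:R); congr nat_of_bool.
rewrite /avoids /fiber all_map all_filter; apply: eq_in_all => c cC /=.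
have cT : (c.1 %| T)%N := allP CT _ cC.
rewrite hits_part ?(dvdn_gt0 T0 cT)//.
by rewrite !hits_modn ?partn_dvd// negb_and -implybE.
Qed.

Lemma common_multiple_fiber T C h : (0 < T)%N -> common_multiple T C ->
  common_multiple T`_pi^' (fiber C h).
Proof.
move=> T0 /allP CT; apply/allP => _ /mapP[c + ->] /=.
by rewrite mem_filter => /andP[_ /CT cT]; rewrite partn_dvd.
Qed.

(** The gcd of the full moduli is at least the product of the gcds of both parts. That of the rough
    parts exceeds 1, hence is at least [Q]; that of the [pi]-parts is traded for their lcm. *)
Lemma correlation_term_le c d : (0 < c.1)%N -> (0 < d.1)%N ->
  (1 < gcdn c.1`_pi^' d.1`_pi^')%N ->
  (c.1`_pi^')%:R^-1 * (d.1`_pi^')%:R^-1 * (lcmn c.1`_pi d.1`_pi)%:R^-1 <=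
  Q^-1 * ((gcdn c.1 d.1)%:R / (c.1%:R * d.1%:R)) :> R.
Proof.
move=> c0 d0 g1.
have Q0 := Q_gt0.
have gQ : Q <= (gcdn c.1`_pi^' d.1`_pi^')%:R.
  by apply: rough_ge => //; apply: pnat_dvd (dvdn_gcdl _ _) (part_pnat _ _).
have gg : (gcdn c.1`_pi d.1`_pi * gcdn c.1`_pi^' d.1`_pi^' <= gcdn c.1 d.1)%N.
  apply: dvdn_leq; first by rewrite gcdn_gt0 c0.
  rewrite dvdn_gcd -[X in (_ %| X)%N && _](partnC pi c0).
  rewrite -[X in _ && (_ %| X)%N](partnC pi d0).
  by rewrite !dvdn_mul ?dvdn_gcdl ?dvdn_gcdr.
have [m0 m'0] : (0 < c.1`_pi /\ 0 < d.1`_pi)%N by rewrite !part_gt0.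
have [n0 n'0] : (0 < c.1`_pi^' /\ 0 < d.1`_pi^')%N by rewrite !part_gt0.
have lg := muln_lcm_gcd c.1`_pi d.1`_pi.
have l0 : (0 < lcmn c.1`_pi d.1`_pi)%N by rewrite lcmn_gt0 m0.
have -> : c.1%:R * d.1%:R =
   (c.1`_pi^')%:R * (d.1`_pi^')%:R * ((lcmn c.1`_pi d.1`_pi)%:R *
   (gcdn c.1`_pi d.1`_pi)%:R) :> R.
  rewrite -[X in _ = _ * X]natrM lg -!natrM; congr (_%:R).
  rewrite -[X in (X * _)%N](partnC pi c0) -[X in (_ * X)%N](partnC pi d0).
  by rewrite mulnACA mulnC.
set l := lcmn _ _ in l0 *; set g := gcdn (c.1`_pi)%N _ in gg *.
set g' := gcdn (c.1`_pi^')%N _ in gg gQ *; set n := (c.1`_pi^')%N in n0 *.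
set n' := (d.1`_pi^')%N in n'0 *.
have g0 : (0 < g)%N by rewrite gcdn_gt0 m0.
have gg' : Q * g%:R <= (gcdn c.1 d.1)%:R.
  apply: (@le_trans _ _ (g' * g)%:R); last by rewrite ler_nat mulnC.
  by rewrite natrM ler_wpM2r.
have -> : n%:R^-1 * n'%:R^-1 * l%:R^-1 =
  (Q^-1 * (Q * g%:R)) / (n%:R * n'%:R * (l%:R * g%:R)) :> R.
  by field; rewrite !pnatr_eq0 -!lt0n l0 g0 n0 n'0 gt_eqF.
by rewrite -mulrA ler_pM2l ?invr_gt0// ler_wpM2r// invr_ge0.
Qed.

Lemma mean_correlation_fiber T C : (0 < T)%N -> common_multiple T C ->
  mean T`_pi (fun h => correlation R (fiber C h)) <=
  Q^-1 * \sum_(c <- C) \sum_(d <- C) (gcdn c.1 d.1)%:R / (c.1%:R * d.1%:R).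
Proof.
move=> T0 /allP CT.
have Q0 := Q_gt0.
pose p c d := (1 < gcdn c.1`_pi^' d.1`_pi^')%N.
rewrite (eq_mean _ (G := fun h => \sum_(c <- C) \sum_(d <- C | p c d)
   ((c.1`_pi^')%:R^-1 * (d.1`_pi^')%:R^-1 *
    (hits (c.1`_pi, c.2)%N h && hits (d.1`_pi, d.2)%N h)%:R))); last first.
  move=> h; rewrite /correlation /fiber big_map big_filter big_mkcond /=.
  apply: eq_bigr => c _; rewrite big_map big_filter_cond /=.
  case: ifP => hc; last by rewrite big1// => d _; rewrite mulr0.
  rewrite big_mkcond [RHS]big_mkcond; apply: eq_bigr => d _ /=.
  by rewrite /p; case: (hits _ h); rewrite ?mulr1 ?mulr0 ?if_same.
rewrite mean_sum mulr_sumr big_seq [leRHS]big_seq ler_sum// => c /CT cC.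
have c0 := dvdn_gt0 T0 cC.
rewrite mean_sum mulr_sumr big_mkcond big_seq [leRHS]big_seq ler_sum// => d /CT dC.
have d0 := dvdn_gt0 T0 dC.
case: ifP => [pcd|_]; last by rewrite !mulr_ge0 ?invr_ge0 ?mulr_ge0// ltW.
rewrite meanZ; apply: le_trans (correlation_term_le c0 d0 pcd).
rewrite ler_wpM2l ?mulr_ge0 ?invr_ge0//.
by apply: (@mean_hits2 _ (c.1`_pi, c.2)%N (d.1`_pi, d.2)%N); rewrite ?part_gt0//= partn_dvd.
Qed.

(* The tangent line of [expR] at [- Lam] replaces the inequality between the
   arithmetic and geometric means of the products over the fibers. *)
Lemma avoids_ge_smooth T C (Lam eta : R) : (0 < T)%N -> common_multiple T C ->
  \sum_(c <- C) c.1%:R^-1 <= Lam ->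
  \sum_(c <- C | (c.1`_pi^' == 1)%N) c.1%:R^-1 <= eta ->
  expR (- Lam) * (1 - eta - Lam * (eta + 2 / Q)) -
    Q^-1 * \sum_(c <- C) \sum_(d <- C) (gcdn c.1 d.1)%:R / (c.1%:R * d.1%:R)
  <= mean T (fun x => (avoids C x)%:R).
Proof.
move=> T0 CT SLam Seta; have Q0 := Q_gt0.
have C0 c : c \in C -> (0 < c.1)%N by move=> /(allP CT)/(dvdn_gt0 T0).
have M0 : (0 < T`_pi)%N by rewrite part_gt0.
have Lam0 : 0 <= Lam by apply: le_trans SLam; rewrite sumr_ge0.
rewrite mean_fiber//.
apply: (@le_trans _ _ (mean T`_pi (fun h => density_product R (fiber C h)) -
  mean T`_pi (fun h => correlation R (fiber C h)))); last first.
  rewrite lerBlDr -meanD; apply: le_mean => h; rewrite -lerBlDr.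
  by apply: avoids_ge; rewrite ?part_gt0// common_multiple_fiber.
apply: lerB; last exact: mean_correlation_fiber.
pose B := [seq c <- C | (c.1`_pi^' == 1)%N].
pose Y h := \sum_(c <- C | (c.1`_pi^' != 1)%N)
  (c.1`_pi^')%:R^-1 * (hits (c.1`_pi, c.2)%N h)%:R : R.
have Y0 h : 0 <= Y h by rewrite sumr_ge0// => c _; rewrite mulr_ge0 ?invr_ge0.
(* If [h] hits [B], the left side is at most 0. Otherwise all moduli on the fibre exceed 1, hence
   are at least [Q], and the product is at least [exp (- (1 + 2 / Q) Y h)], to which the tangent
   line applies. *)
have key h : expR (- Lam) * ((1 + Lam) * (avoids B h)%:R - (1 + 2 / Q) * Y h) <=
    density_product R (fiber C h).
  case: (boolP (avoids B h)) => [aB|_]; last first.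
    apply: (@le_trans _ _ 0).
      by rewrite mulr0 sub0r pmulr_rle0 ?expR_gt0// oppr_le0 mulr_ge0// addr_ge0//
        divr_ge0// ltW.
    apply: density_product_ge0 => _ /mapP[c _ ->] /=.
    by rewrite part_gt0.
  have B1 c : c \in C -> hits (c.1`_pi, c.2)%N h -> (c.1`_pi^' != 1)%N.
    move=> cC hc; apply/negP => c1.
    have /(allP aB)/negP : c \in B by rewrite mem_filter c1.
    by apply; rewrite hits_part ?C0// hc (eqP c1) /hits !modn1.
  have fQ : {in fiber C h, forall c, Q <= c.1%:R}.
    move=> _ /mapP[c + ->] /=; rewrite mem_filter => /andP[hc cC].
    apply: rough_ge; first exact: part_pnat.
    by rewrite ltn_neqAle eq_sym B1//= part_gt0.
  apply: le_trans (density_product_ge Q2 fQ).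
  have -> : \sum_(c <- fiber C h) c.1%:R^-1 = Y h.
    rewrite /fiber big_map big_filter /Y big_mkcond [RHS]big_mkcond.
    apply: eq_big_seq => c cC /=.
    case: ifP => hc; first by rewrite B1// mulr1.
    by rewrite mulr0; case: ifP.
  rewrite mulr1 -ler_pdivlMl ?expR_gt0// -expRN opprK -expRD.
  by apply: le_trans (expR_ge1Dx _); rewrite addrA.
apply: le_trans (le_mean _ key); rewrite meanZ ler_wpM2l ?expR_ge0//.
(* Averaging over [h] restores the [pi]-part of each modulus: every class counted in [Y] contributes
   its full density. *)
have EY : mean T`_pi Y <= Lam.
  apply: le_trans SLam; rewrite /Y mean_sum big_mkcond big_seq [leRHS]big_seq.
  rewrite ler_sum// => c cC; case: ifP => // _.
  rewrite meanZ (@mean_hits _ _ (c.1`_pi, c.2)%N)//; last first.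
    by rewrite partn_dvd// (allP CT).
  by rewrite -invfM -natrM mulnC partnC// C0.
have EB : 1 - eta <= mean T`_pi (fun h => (avoids B h)%:R).
  apply: le_trans (lerB (lexx 1) Seta) _; rewrite lerBlDr.
  have -> : \sum_(c <- C | (c.1`_pi^' == 1)%N) c.1%:R^-1 =
      mean T`_pi (fun h => \sum_(c <- B) (hits c h)%:R) :> R.
    rewrite mean_sum -big_filter; apply: eq_big_seq => c.
    rewrite mem_filter => /andP[c1 cC].
    rewrite mean_hits// -(partnC pi (C0 _ cC)) (eqP c1) muln1 partn_dvd//.
    exact: (allP CT).
  rewrite -meanD -{1}(mean_const (1 : R) M0); apply: le_mean => h.
  have [_|] := boolP (avoids B h); first by rewrite lerDl sumr_ge0.
  rewrite -has_predC => /hasP[d dC]; rewrite /= negbK => hd.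
  by rewrite add0r (big_rem d dC)/= hd lerDl sumr_ge0.
have -> : mean T`_pi (fun h => (1 + Lam) * (avoids B h)%:R - (1 + 2 / Q) * Y h) =
  (1 + Lam) * mean T`_pi (fun h => (avoids B h)%:R) - (1 + 2 / Q) * mean T`_pi Y.
  rewrite -mulNr -!meanZ -meanD; apply: eq_mean => h; by rewrite mulNr.
have Qi : 0 <= 2 / Q by rewrite divr_ge0// ltW.
move: EY EB; set y := mean _ _; set b := mean _ _; move=> EY EB.
nra.
Qed.
End SmoothPart.

(** * Density *)

Section Density.
Variable R : realType.

(** [n] is compared with the multiples of [T] around it, where the count is exact. *)
Lemma count_iota_dist (P : pred nat) (T n : nat) : (0 < T)%N ->
  (forall x, P (x + T)%N = P x) ->
  `|(count P (iota 1 n))%:R - n%:R * mean T (fun x => (P x)%:R)| <= T%:R + 1 :> R.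
Proof.
move=> T0 PT; set m := mean _ _.
pose c k : R := \sum_(x < k) (P x)%:R.
(* [iota 1 n] starts at 1 while [c] counts from 0; the correction [P 0] accounts for the [+ 1] in
   the bound. *)
have cE : (count P (iota 1 n))%:R = c n.+1 - (P 0%N)%:R.
  rewrite /c big_ord_recl addrC addKr -sum1_count natr_sum big_mkcond /=.
  rewrite -[n in iota 1 n]subn0 -subSS -/(index_iota 1 n.+1) big_add1 big_mkord.
  by apply: eq_bigr => i _; rewrite /bump leq0n add1n; case: (P _).
have ckT k : c (k * T)%N = (k * T)%:R * m.
  case: k => [|k]; first by rewrite /c mul0n big_ord0 mul0r.
  rewrite /m -(@mean_periodic _ k.+1)// => [|x]; last by rewrite PT.
  by rewrite /mean /c mulrC mulfVK// pnatr_eq0 -lt0n muln_gt0.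
have cle j k : (j <= k)%N -> c j <= c k.
  move=> /subnKC <-; rewrite /c big_split_ord /= lerDl sumr_ge0//.
have m0 : 0 <= m by apply: mean_ge0.
have m1 : m <= 1.
  by rewrite -(mean_const (1 : R) T0); apply: le_mean => x; case: (P x).
pose k := (n %/ T)%N.
have nk : n = (k * T + n %% T)%N := divn_eq n T.
have nT : (n %% T < T)%N by rewrite ltn_mod.
have lo : c (k * T)%N <= c n.+1 by apply: cle; lia.
have hi : c n.+1 <= c (k.+1 * T)%N by apply: cle; lia.
rewrite cE; move: lo hi; rewrite !ckT.
have kn : (k * T)%:R <= n%:R :> R by rewrite ler_nat; lia.
have nk1 : n%:R <= (k * T)%:R + T%:R :> R by rewrite -natrD ler_nat; lia.
rewrite mulSn natrD.
have p1 : (P 0%N)%:R <= 1 :> R by case: (P 0%N).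
have p0 : 0 <= (P 0%N)%:R :> R by case: (P 0%N).
have := ler0n R T.
move: p0 p1 kn nk1; set a := (k * T)%:R; set t := T%:R; set p := (P 0%N)%:R.
set x := n%:R => p0 p1 kn nk1 t0 lo hi.
by rewrite ler_norml; apply/andP; split; nra.
Qed.

Lemma count_iota_cvg (P : pred nat) (T : nat) : (0 < T)%N ->
  (forall x, P (x + T)%N = P x) ->
  ((fun n : nat => (count P (iota 1 n))%:R / n%:R : R) @ \oo -->
     mean T (fun x => (P x)%:R))%classic.
Proof.
move=> T0 PT; apply/cvgrPdist_le => e e0; near=> n.
have n0 : 0 < n%:R :> R by rewrite ltr0n; near: n; exact: nbhs_infty_gt.
rewrite distrC -(ler_pM2r n0) -[X in _ * X <= _](gtr0_norm n0) -normrM mulrBl divfK ?gt_eqF//.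
rewrite [X in `|_ - X|]mulrC.
apply: le_trans (count_iota_dist n T0 PT) _.
rewrite -ler_pdivrMl// mulrC; near: n; exact: nbhs_infty_ger.
Unshelve. all: by end_near. Qed.

(** The uncovered set is periodic modulo [T], so the limit in [density] exists and is the mean over
    one period. *)
Lemma deltaE (C : {fset nat * nat}) (T : nat) : (0 < T)%N -> common_multiple T C ->
  delta R C = mean T (fun x => (avoids C x)%:R).
Proof.
move=> T0 CT; rewrite /delta /density.
have -> : (fun n : nat => (count (fun m : nat => m%:Z \in uncovered C) (iota 1 n))%:R
     / n%:R : R) = (fun n : nat => (count (avoids C) (iota 1 n))%:R / n%:R).
  apply/funext => n; congr (_%:R / _); apply: eq_count => m.
  apply/idP/allP => [|H].
    rewrite inE => H [k r] /H/=; rewrite /hits /= !modz_nat.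
    by apply: contra => /eqP ->.
  rewrite inE => k r /H; rewrite /hits /= !modz_nat.
  by apply: contra => /eqP [->].
apply/cvg_lim => //; apply: count_iota_cvg => // x.
by rewrite -(avoids_modn _ CT) modnDr avoids_modn.
Qed.

Lemma alphaE (C : {fset nat * nat}) : alpha R C = density_product R C.
Proof.
rewrite /alpha /moduli (perm_big _ (perm_eq_seq_mset _)) /=.
by rewrite big_map.
Qed.

(** Classes are grouped by modulus, each value [n] being counted with its multiplicity, at most
    [s]. *)
Lemma sum_moduli_le (C : {fset nat * nat}) (s : R) (P : pred nat) (Z : nat)
    (F : nat -> R) : 0 <= s -> (forall n, 0 <= F n) ->
  (forall n, n \in moduli C -> [/\ P n, (0 < n < Z)%N & (moduli C n)%:R <= s]) ->
  \sum_(c <- C) F c.1 <= s * \sum_(1 <= n < Z | P n) F n.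
Proof.
move=> s0 F0 CP.
have CE n : moduli C n = count_mem n [seq c.1 | c <- C] by rewrite mset_seqE.
have CM n : n \in moduli C = (n \in [seq c.1 | c <- C]).
  by rewrite (perm_mem (perm_eq_seq_mset _)).
rewrite -(big_map fst xpredT F) /=.
set S := [seq _ | _ <- C] in CE CM *.
rewrite (bigID (mem (index_iota 1 Z))) /= [X in _ + X]big1_seq ?addr0; last first.
  move=> n /andP[+ nS]; have [] := CP n; first by rewrite CM.
  by move=> _ /andP[n0 nZ] _; rewrite mem_index_iota n0 nZ.
rewrite [leLHS](_ : _ = \sum_(1 <= n < Z) (count_mem n S)%:R * F n); last first.
  under [RHS]eq_bigr => n _ do rewrite mulr_natl.
  elim: S {CE CM} => [|a S IH].
    by rewrite big_nil big1// => n _; rewrite mulr0n.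
  rewrite big_cons; under [RHS]eq_bigr => n _ do rewrite /= mulrnDr.
  rewrite big_split /= -IH; case: ifP => aZ.
    congr (_ + _); rewrite (bigD1_seq a) ?iota_uniq//= eqxx mulr1n.
    rewrite big1 ?addr0// => n /negPf na.
    by rewrite eq_sym na mulr0n.
  rewrite [X in X + _]big1_seq ?add0r// => n /= nZ.
  by case: eqP => // an; rewrite an nZ in aZ.
rewrite mulr_sumr [leRHS]big_mkcond; apply: ler_sum => n _.
have [nS|nS] := boolP (n \in S).
  have [|Pn _ ns] := CP n; first by rewrite CM.
  by rewrite Pn ler_wpM2r// -CE.
rewrite (count_memPn nS) mul0r; case: ifP => // _.
by rewrite mulr_ge0.
Qed.
End Density.

(** * Smooth numbers *)

Section Smooth.
Variable R : realType.

Lemma inv_le_ln_ratio (n : nat) : (0 < n)%N -> n.+1%:R^-1 <= ln (n.+1%:R / n%:R) :> R.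
Proof.
move=> n0; have n0' : 0 < n%:R :> R by rewrite ltr0n.
have n1' : 0 < n.+1%:R :> R by rewrite ltr0n.
rewrite -invf_div lnV ?posrE ?divr_gt0// lerNr.
have -> : n%:R / n.+1%:R = 1 + - n.+1%:R^-1 :> R.
  by rewrite -natr1; field; rewrite natr1 gt_eqF.
apply: le_ln1Dx; rewrite ltrN2 invf_lt1// ltr1n ltnS; exact: n0.
Qed.

(** The first term is at most [c], and each later [1 / (n + 1)] is at most [ln ((n + 1) / n)], which
    telescopes. *)
Lemma sum_inv_le (x y c : R) (Z : nat) : 0 < x -> x <= y ->
  (forall n, (0 < n)%N -> x < n%:R -> n%:R^-1 <= c) -> 0 <= c ->
  \sum_(1 <= n < Z.+1 | (x < n%:R) && (n%:R <= y)) n%:R^-1 <= c + ln (y / x).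
Proof.
move=> x0 xy cx c0.
have ln0 a b : 0 < a -> a <= b -> 0 <= ln (b / a) :> R.
  by move=> a0 ab; rewrite ln_ge0// ler_pdivlMr// mul1r.
elim: Z y xy => [|Z IH] y xy; first by rewrite big_geq// addr_ge0// ln0.
rewrite big_mkcond big_nat_recr//= -big_mkcond /=.
case: ifP => [/andP[xZ Zy]|_]; last by rewrite addr0 IH.
have [Zx|] := lerP (Z%:R) x.
  rewrite big1_seq ?add0r; last first.
    move=> n; rewrite mem_index_iota => /andP[/andP[xn _] /andP[_ nZ]].
    have : (n%:R <= Z%:R :> R) by rewrite ler_nat.
    by rewrite leNgt (le_lt_trans Zx).
  by apply: le_trans (cx Z.+1 _ xZ) _ => //; rewrite lerDl ln0.
move=> /ltW xZ'; have Z0 : 0 < Z%:R :> R by apply: lt_le_trans xZ'.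
have -> : \sum_(1 <= n < Z.+1 | (x < n%:R) && (n%:R <= y)) n%:R^-1 =
    \sum_(1 <= n < Z.+1 | (x < n%:R) && (n%:R <= Z%:R :> R)) n%:R^-1 :> R.
  apply: congr_big_nat => // n /andP[n1 nZ].
  rewrite ler_nat; have -> : (n <= Z)%N by [].
  by rewrite (le_trans _ Zy) ?ler_nat ?(ltnW nZ).
apply: (@le_trans _ _ (c + ln (Z%:R / x) + ln (Z.+1%:R / Z%:R))).
  by rewrite lerD ?IH// inv_le_ln_ratio// -(ltr0n R).
rewrite -addrA lerD2l -lnM ?posrE ?divr_gt0//.
rewrite mulrC mulrA divfK ?gt_eqF// ler_ln ?posrE ?divr_gt0 ?(lt_le_trans x0)//.
by rewrite ler_wpM2r// invr_ge0 ltW.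
exact: ltW.
Qed.

(** [n %/ p] is the first term of Legendre's formula for the exponent of [p] in [n!], and powers of
    distinct primes are coprime. *)
Lemma primorial_quotients_dvd (n k : nat) : (0 < n)%N ->
  (\prod_(p < k | prime p) p ^ (n %/ p) %| n`!)%N.
Proof.
move=> n0; elim: k => [|k IH]; first by rewrite big_ord0 dvd1n.
rewrite big_mkcond big_ord_recr -big_mkcond /=; case: ifP => [pk|]; last by rewrite muln1.
rewrite Gauss_dvd ?IH /=.
  rewrite pfactor_dvdn ?fact_gt0// logn_fact//.
  by rewrite big_nat_recl//= expn1 leq_addr.
apply: (big_ind (fun a => coprime a (k ^ (n %/ k)))) => [||p pp].
  exact: coprime1n.
  by move=> a b ca cb; rewrite coprimeMl ca.
rewrite coprimeXl// coprimeXr// prime_coprime// dvdn_prime2//.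
by rewrite neq_ltn ltn_ord.
Qed.

(* Legendre's formula for [n!] gives this with no use of Chebyshev's bounds. *)
Lemma sum_ln_prime_le (n : nat) : (0 < n)%N ->
  \sum_(p < n.+1 | prime p) ln p%:R / p%:R <= 2 * ln n%:R :> R.
Proof.
move=> n0; have n0' : 0 < n%:R :> R by rewrite ltr0n.
have H : ln (\prod_(p < n.+1 | prime p) p ^ (n %/ p))%N%:R <= ln (n`!%:R : R).
  rewrite ler_ln ?posrE ?ltr0n ?fact_gt0 ?prodn_gt0//.
    by rewrite ler_nat dvdn_leq ?fact_gt0 ?primorial_quotients_dvd.
  by move=> p; rewrite expn_gt0; case: (p : nat).
have Hn : ln (n`!%:R : R) <= n%:R * ln n%:R.
  rewrite mulr_natl -lnXn// ler_ln ?posrE ?exprn_gt0 ?ltr0n ?fact_gt0//.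
  rewrite -natrX ler_nat -ffactnn.
  rewrite ffact_prod -[X in (_ <= _ ^ X)%N]card_ord -prod_nat_const.
  by apply: leq_prod => i _; rewrite leq_subr.
have HP : ln (\prod_(p < n.+1 | prime p) p ^ (n %/ p))%N%:R =
    \sum_(p < n.+1 | prime p) (n %/ p)%:R * ln p%:R :> R.
  have [] // : (0 < \prod_(p < n.+1 | prime p) p ^ (n %/ p))%N /\
      ln (\prod_(p < n.+1 | prime p) p ^ (n %/ p))%N%:R =
      \sum_(p < n.+1 | prime p) (n %/ p)%:R * ln p%:R :> R.
  apply: (big_rec2 (fun a (b : R) => (0 < a)%N /\ ln a%:R = b)).
    by rewrite ln1.
  move=> p a b pp [a0 <-]; have p0 := prime_gt0 pp.
  rewrite muln_gt0 expn_gt0 p0 a0; split=> //.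
  rewrite natrM lnM ?posrE ?ltr0n ?expn_gt0 ?p0//.
  by rewrite natrX lnXn ?ltr0n// mulr_natl.
rewrite -(ler_pM2l n0') mulr_sumr mulrCA.
apply: le_trans (ler_wpM2l (ler0n R 2) (le_trans _ Hn)); last exact: H.
rewrite HP mulr_sumr ler_sum// => p pp; have p0 := prime_gt0 pp.
have pn : (p <= n)%N by rewrite -ltnS.
(* Dropping the integer part costs the factor 2 of the statement, as [n / p >= 1]. *)
have n2 : n%:R <= 2 * (n %/ p)%:R * p%:R :> R.
  rewrite -!natrM ler_nat; have := divn_eq n p; have := ltn_pmod n p0.
  have : (0 < n %/ p)%N by rewrite divn_gt0.
  nia.
have p0' : 0 < p%:R :> R by rewrite ltr0n.
rewrite mulrA ler_pdivrMr// [leRHS](_ : _ = 2 * (n %/ p)%:R * p%:R * ln p%:R).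
  by rewrite ler_wpM2r// ln_ge0// ler1n.
by ring.
Qed.

(** For [n > 0], the largest divisor of [n] with all its primes below [k]; a nonprime [p]
    contributes 1, since then [logn p n = 0]. *)
Definition smooth_part (k n : nat) : nat := (\prod_(p < k) p ^ logn p n)%N.

Lemma smooth_partS k n :
  smooth_part k.+1 n = (smooth_part k n * k ^ logn k n)%N.
Proof. by rewrite /smooth_part big_ord_recr. Qed.

Lemma smooth_part_Mprime k p m : prime p -> (k <= p)%N -> (0 < m)%N ->
  smooth_part k (p * m) = smooth_part k m.
Proof.
move=> pp kp m0; apply: eq_bigr => q _; rewrite lognM ?(prime_gt0 pp)// logn_prime//.
by rewrite (_ : (q == p :> nat) = false)// ltn_eqF// (leq_trans _ kp).
Qed.

Lemma smooth_partS_Mprime p m : prime p -> (0 < m)%N ->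
  smooth_part p.+1 (p * m) = (p * smooth_part p.+1 m)%N.
Proof.
move=> pp m0; rewrite !smooth_partS smooth_part_Mprime// lognM ?(prime_gt0 pp)//.
by rewrite logn_prime// eqxx add1n expnS mulnCA.
Qed.

Lemma smooth_part_id k n : (0 < n)%N ->
  (n`_([pred p | (p < k)%N] : nat_pred)^' == 1)%N -> smooth_part k n = n.
Proof.
set pi := [pred p | _]; move=> n0 /eqP n1.
rewrite -[RHS](partnC pi n0) n1 muln1 (@widen_partn (maxn n k)) ?leq_maxl//.
rewrite /smooth_part -(big_mkord xpredT (fun p => p ^ logn p n)%N).
by rewrite (big_nat_widen _ _ (maxn n k).+1)// leqW// leq_maxr.
Qed.

Lemma big_nat_dvd (p Z : nat) (P : pred nat) (F : nat -> R) : (0 < p)%N ->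
  \sum_(1 <= n < Z.+1 | P n && (p %| n)%N) F n =
  \sum_(1 <= m < (Z %/ p).+1 | P (p * m)%N) F (p * m)%N.
Proof.
move=> p0.
rewrite -(big_map (muln p) P F) -[RHS]big_filter -[LHS]big_filter; apply: perm_big.
apply: uniq_perm; rewrite ?filter_uniq ?iota_uniq//.
  by rewrite map_inj_uniq ?iota_uniq// => a b /eqP; rewrite eqn_pmul2l// => /eqP.
move=> n; rewrite !mem_filter mem_index_iota andbAC -andbA; congr (_ && _).
apply/idP/mapP => [/andP[/andP[n1 nZ] /dvdnP[m nE]]|[m + ->]].
  exists m; last by rewrite mulnC.
  rewrite mem_index_iota ltnS leq_divRL// -nE; lia.
rewrite mem_index_iota dvdn_mulr// andbT !ltnS leq_divRL// mulnC => /andP[m0 ->].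
by rewrite muln_gt0 m0 p0.
Qed.
End Smooth.

(** * Rankin's bound for smooth numbers in a multiplicative interval *)

Section SmoothSum.
Variable R : realType.
Variables (sigma K : R).
Hypotheses (sigma_ge0 : 0 <= sigma) (sigma_le : sigma <= 1 / 2) (K_ge1 : 1 <= K).

Let f k n : R := (smooth_part k n)%:R `^ sigma.
(** [Z] only truncates the sum and serves as induction variable; the bounds are uniform in [Z] and
    [x], as needed to pass from [x] to [x / p]. *)
Let S k Z (x : R) := \sum_(1 <= n < Z.+1 | (x < n%:R) && (n%:R <= K * x)) f k n / n%:R.
Let c p : R := 4 * (p%:R `^ sigma - 1) / p%:R.

(** As [sigma <= 1 / 2], the power is at most [sqrt p], which is below [3 / 4 * p] from [p = 2] on.
    Hence [p - p^sigma >= p / 4], the source of the 4 in [c]. *)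
Let powR_prime_le p : prime p -> p%:R `^ sigma <= 3 / 4 * p%:R.
Proof.
move=> pp; have p2 : 2 <= p%:R :> R by rewrite ler_nat prime_gt1.
apply: (@le_trans _ _ (p%:R `^ (2^-1))).
  rewrite ler_powR//; first by lra.
  by move: sigma_le; lra.
rewrite powR12_sqrt//.
have := sqr_sqrtr (ler0n R p); have := sqrtr_ge0 (p%:R : R).
set q := Num.sqrt _; move: p2; set r := p%:R => r2 q0 qr.
nra.
Qed.

Let powR_ge1 p : prime p -> 1 <= p%:R `^ sigma.
Proof.
move=> pp; rewrite -[leLHS](powRr0 p%:R); apply: ler_powR => //.
by rewrite ler1n prime_gt0.
Qed.

Let f_dvd p m : prime p -> (0 < m)%N ->
  f p.+1 (p * m) - f p (p * m) = p%:R `^ sigma * f p.+1 m - f p m.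
Proof.
by move=> pp m0; rewrite /f (@smooth_part_Mprime p p)// smooth_partS_Mprime// natrM powRM.
Qed.

(** Passing from [p] to [p + 1] changes only the terms with [p] dividing [n]. Put [w = p^sigma].
    Writing [n = p * m], the increment at [x] is [1 / p] times the sum of [w] times the increment at
    [x / p] and [w - 1] times the old sum there. Strong induction on [Z] closes this since
    [w <= 3 / 4 * p]. *)
Let S_step p B : prime p -> 0 <= B -> (forall Z x, 0 < x -> S p Z x <= B) ->
  forall Z x, 0 < x -> S p.+1 Z x <= (1 + c p) * B.
Proof.
move=> pp B0 SB Z x x0.
have p0 := prime_gt0 pp; have p0' : 0 < p%:R :> R by rewrite ltr0n.
have w1 := powR_ge1 pp; have w2 := powR_prime_le pp.
set w := p%:R `^ sigma in w1 w2.
have c0 : 0 <= c p by rewrite /c divr_ge0 ?mulr_ge0 ?subr_ge0// ltW.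
suff D : S p.+1 Z x - S p Z x <= c p * B.
  by have := SB Z x x0; lra.
elim/ltn_ind: Z x x0 => Z IH x x0.
have [->|Z0] := posnP Z; first by rewrite /S !big_geq// subrr mulr_ge0.
rewrite /S -sumrB.
rewrite [leLHS](_ : _ = \sum_(1 <= n < Z.+1 | ((x < n%:R) && (n%:R <= K * x)) && (p %| n)%N)
    (f p.+1 n - f p n) / n%:R); last first.
  rewrite [RHS]big_mkcondr; apply: eq_bigr => n _; rewrite -mulrBl.
  case: ifPn => // pn; rewrite /f smooth_partS logn_coprime ?prime_coprime//.
  by rewrite muln1 subrr mul0r.
rewrite (big_nat_dvd Z (fun n => (x < n%:R) && (n%:R <= K * x)) _ p0).
rewrite (_ : \sum_(1 <= m < _ | _) _ =
  p%:R^-1 * (w * (S p.+1 (Z %/ p) (x / p%:R) - S p (Z %/ p) (x / p%:R))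
       + (w - 1) * S p (Z %/ p) (x / p%:R))); last first.
  rewrite /S -sumrB !mulr_sumr -big_split mulr_sumr.
  rewrite big_nat_cond [RHS]big_nat_cond.
  apply: eq_big => [m|m /andP[/andP[m1 _] _]].
    by rewrite natrM ltr_pdivrMr// [m%:R * _]mulrC mulrA ler_pdivlMr// [m%:R * _]mulrC.
  have m0 : m%:R != 0 :> R by rewrite pnatr_eq0 -lt0n.
  rewrite f_dvd// -/w natrM /=; field.
  by rewrite m0 gt_eqF.
have xp : 0 < x / p%:R by rewrite divr_gt0.
have h1 := IH _ (ltn_Pdiv (prime_gt1 pp) Z0) _ xp.
have h2 := SB (Z %/ p)%N _ xp.
rewrite ler_pdivrMl//.
apply: (@le_trans _ _ (w * (c p * B) + (w - 1) * B)).
  by rewrite lerD// ler_wpM2l//; lra.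
rewrite mulrA -mulrDl [leRHS]mulrA; apply: ler_wpM2r => //.
have -> : p%:R * c p = 4 * (w - 1) by rewrite /c -/w; field; rewrite gt_eqF.
suff : w * c p <= 3 * (w - 1) by lra.
rewrite /c -/w mulrA ler_pdivrMr//.
have : 0 <= w - 1 by lra.
nra.
Qed.

(** For [k = 0] the sum is at most [1 + ln K]; each prime then multiplies the bound by
    [1 + c p <= exp (c p)]. *)
Lemma sum_smooth_part_le k Z x : 0 < x ->
  \sum_(1 <= n < Z.+1 | (x < n%:R) && (n%:R <= K * x))
    (smooth_part k n)%:R `^ sigma / n%:R <=
  expR (\sum_(p < k | prime p) 4 * (p%:R `^ sigma - 1) / p%:R) * (1 + ln K).
Proof.
rewrite -/(S k Z x); elim: k Z x => [|k IH] Z x x0.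
  rewrite big_ord0 expR0 mul1r /S.
  have E : K * x / x = K by rewrite mulfK// gt_eqF.
  rewrite -[in ln K]E; under eq_bigr => n _ do rewrite /f /smooth_part big_ord0 powR1 mul1r.
  apply: sum_inv_le => //; first by rewrite ler_peMl// ltW.
  by move=> n n0 _; rewrite invf_le1 ?ltr0n// ler1n.
rewrite big_mkcond big_ord_recr -big_mkcond /=.
case: ifPn => pk; last first.
  rewrite addr0; apply: le_trans (IH Z x x0); rewrite le_eqVlt; apply/orP; left.
  apply/eqP; apply: eq_bigr => n _; rewrite /f smooth_partS lognE.
  by rewrite (negPf pk) muln1.
rewrite expRD -[leRHS]mulrA [leRHS]mulrCA.
apply: (@le_trans _ _ ((1 + c k) * (expR (\sum_(p < k | prime p) c p) * (1 + ln K)))).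
  apply: S_step => //.
  by rewrite mulr_ge0 ?expR_ge0// addr_ge0// ln_ge0.
rewrite ler_wpM2r ?expR_ge1Dx//.
by rewrite mulr_ge0 ?expR_ge0// addr_ge0// ln_ge0.
Qed.

(* The exponent uses [1 - expR (- t) <= t] with [t = sigma * ln p]. *)
Lemma sum_smooth_le (k Z : nat) (W x : R) : (0 < k)%N -> 0 < x ->
  k%:R `^ sigma <= W ->
  \sum_(1 <= n < Z.+1 | [&& x < n%:R, n%:R <= K * x &
      (n`_([pred p | (p < k.+1)%N] : nat_pred)^' == 1)%N]) n%:R^-1 <=
  x `^ (- sigma) * expR (8 * sigma * W * ln k%:R) * (1 + ln K).
Proof.
move=> k0 x0 kW.
have K0 : 0 <= 1 + ln K by rewrite addr_ge0// ln_ge0.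
have xs0 : 0 < x `^ sigma by rewrite powR_gt0.
rewrite -mulrA powRN ler_pdivlMl//.
(* Rankin's trick: a smooth [n > x] is its own smooth part, so [x^sigma] is at most
   [smooth_part^sigma]; the smoothness condition is then dropped. *)
apply: (@le_trans _ _ (S k.+1 Z x)).
  rewrite mulr_sumr (eq_bigl _ _ (fun n => andbA _ _ _)) big_mkcondr /S.
  rewrite big_nat_cond [leRHS]big_nat_cond.
  apply: ler_sum => n /andP[/andP[n1 _] /andP[xn _]].
  case: ifP => smooth; last by rewrite divr_ge0 ?powR_ge0.
  rewrite /f smooth_part_id// ler_wpM2r ?invr_ge0//.
  by rewrite ge0_ler_powR ?nnegrE ?ler0n ?(ltW x0) ?(ltW xn).
apply: le_trans (sum_smooth_part_le _ _ x0) _.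
rewrite ler_wpM2r// ler_expR.
apply: (@le_trans _ _ (\sum_(p < k.+1 | prime p) (4 * sigma * W) * (ln p%:R / p%:R))).
  apply: ler_sum => p pp.
  have p0 : 0 < p%:R :> R by rewrite ltr0n prime_gt0.
  rewrite [leRHS]mulrA; apply: ler_wpM2r; first by rewrite invr_ge0 ltW.
  rewrite -!mulrA ler_wpM2l//.
  have pW : p%:R `^ sigma <= W.
    apply: le_trans kW; rewrite ge0_ler_powR ?nnegrE// ler_nat -ltnS; exact: ltn_ord.
  have lnp : 0 <= ln p%:R :> R by rewrite ln_ge0// ler1n prime_gt0.
  have -> : p%:R `^ sigma = expR (sigma * ln p%:R) by rewrite /powR gt_eqF.
  have := expR_ge1Dx (- (sigma * ln p%:R)).
  rewrite expRN; move: pW; have -> : p%:R `^ sigma = expR (sigma * ln p%:R).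
    by rewrite /powR gt_eqF.
  have := expR_gt0 (sigma * ln p%:R).
  have : 0 <= sigma * ln p%:R by rewrite mulr_ge0.
  rewrite [W * _]mulrC mulrA; set t := sigma * _; set e := expR _ => t0 e0 eW.
  move=> H; have {}H : e * (1 - t) <= 1 by rewrite -ler_pdivlMl// mulr1.
  nra.
rewrite -mulr_sumr.
(* The constant 8 is the 4 of [c] times the 2 of [sum_ln_prime_le]. *)
have := sum_ln_prime_le R k0; set A := \sum_(_ < _ | _) _ => HA.
have : 0 <= sigma * W by rewrite mulr_ge0// (le_trans _ kW)// powR_ge0.
set a := sigma * W => a0.
rewrite -[X in X * A]mulrA -[8 * _ * W]mulrA -/a.
nra.
Qed.
End SmoothSum.

(** * The lower bound with explicit error terms *)

Section Assembly.
Variable R : realType.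

Lemma harmonic_le (Z : nat) : (0 < Z)%N ->
  \sum_(1 <= n < Z.+1) n%:R^-1 <= 2 + ln Z%:R :> R.
Proof.
move=> Z0; have Z1 : 1 <= Z%:R :> R by rewrite ler1n.
(* The lower end [1 / 2] keeps [n = 1] in the range, at a cost of [ln 2 <= 1]. *)
have H : \sum_(1 <= n < Z.+1 | (2^-1 < n%:R :> R) && (n%:R <= Z%:R :> R)) n%:R^-1 <=
    1 + ln (Z%:R / 2^-1) :> R.
  apply: sum_inv_le => //; first by lra.
  by move=> n n0 _; rewrite invf_le1 ?ltr0n// ler1n.
apply: (@le_trans _ _ (1 + ln (Z%:R / 2^-1))).
  move: H; congr (_ <= _); rewrite big_nat_cond [RHS]big_nat_cond.
  apply: eq_bigl => n; apply/andP/andP => [[]//|[/andP[n1 nZ] _]].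
  split; first by rewrite n1.
  rewrite ler_nat -ltnS nZ andbT (@lt_le_trans _ _ 1) ?ler1n//.
  by lra.
rewrite invrK lnM ?posrE//; last by lra.
have : ln (1 + 1) <= 1 :> R by rewrite le_ln1Dx//; lra.
have -> : (1 + 1 : R) = 2 by [].
lra.
Qed.

Lemma sum_inv_dvd_le (d Z : nat) : (0 < d)%N ->
  \sum_(1 <= n < Z.+1 | (d %| n)%N) n%:R^-1 <=
  d%:R^-1 * \sum_(1 <= n < Z.+1) n%:R^-1 :> R.
Proof.
move=> d0; rewrite (big_nat_dvd Z xpredT (fun n => n%:R^-1 : R) d0).
under eq_bigr do rewrite natrM invfM.
rewrite -mulr_sumr ler_wpM2l ?invr_ge0//.
rewrite [leRHS](@big_cat_nat _ _ _ (Z %/ d).+1)//=; last by rewrite ltnS leq_div.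
by rewrite lerDl sumr_ge0// => n _; rewrite invr_ge0.
Qed.

(** Bound [gcdn n m] by the sum of its divisors [d] and exchange the sums: [d] contributes
    [d * (a d)^2], where [a d <= H / d], and summing [H^2 / d] gives [H^3]. *)
Lemma sum_gcd_le (Z : nat) :
  \sum_(1 <= n < Z.+1) \sum_(1 <= m < Z.+1) (gcdn n m)%:R / (n%:R * m%:R) <=
  (\sum_(1 <= n < Z.+1) n%:R^-1) ^+ 3 :> R.
Proof.
set H := \sum_(1 <= n < Z.+1) n%:R^-1.
have H0 : 0 <= H by rewrite sumr_ge0// => n _; rewrite invr_ge0.
pose a d : R := \sum_(1 <= n < Z.+1) (d %| n)%:R / n%:R.
have aH d : (0 < d)%N -> a d <= d%:R^-1 * H.
  move=> d0; apply: le_trans (sum_inv_dvd_le Z d0).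
  rewrite [leRHS]big_mkcond; apply: ler_sum => n _.
  by case: (d %| n)%N; rewrite ?mul1r ?mul0r.
apply: (@le_trans _ _ (\sum_(1 <= d < Z.+1) d%:R * (a d * a d))).
  under [leRHS]eq_bigr => d _ do rewrite /a mulr_suml mulr_sumr.
  rewrite [leRHS]exchange_big [leLHS]big_nat [leRHS]big_nat /=.
  apply: ler_sum => n /andP[n0 nZ].
  under [leRHS]eq_bigr => d _ do rewrite !mulr_sumr.
  rewrite [leRHS]exchange_big [leLHS]big_nat [leRHS]big_nat /=.
  apply: ler_sum => m /andP[m0 mZ].
  have g0 : (0 < gcdn n m)%N by rewrite gcdn_gt0 n0.
  have gZ : (gcdn n m < Z.+1)%N.
    by apply: leq_ltn_trans nZ; rewrite dvdn_leq// dvdn_gcdl.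
  rewrite (bigD1_seq (gcdn n m)) ?iota_uniq ?mem_index_iota ?g0//=.
  rewrite dvdn_gcdl dvdn_gcdr !mul1r invfM lerDl.
  by rewrite sumr_ge0// => d _; rewrite !mulr_ge0 ?invr_ge0.
rewrite exprS expr2 -[in leRHS]/H {1}/H mulr_suml [leLHS]big_nat [leRHS]big_nat.
apply: ler_sum => d /andP[d0 _].
have a0 : 0 <= a d by rewrite sumr_ge0// => n _; rewrite mulr_ge0 ?invr_ge0.
have d0' : 0 < d%:R :> R by rewrite ltr0n.
have -> : d%:R^-1 * (H * H) = d%:R * ((d%:R^-1 * H) * (d%:R^-1 * H)).
  by field; rewrite gt_eqF.
by rewrite ler_wpM2l// ler_pM// aH.
Qed.

(** * Moduli between N and K N *)

Section Bound.
Variables (N s K Q sigma : R) (C : {fset nat * nat}).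
Hypotheses (N2 : 2 <= N) (s1 : 1 <= s) (K1 : 1 <= K) (Q2 : 2 <= Q).
Hypotheses (sigma0 : 0 <= sigma) (sigma1 : sigma <= 1 / 2).
Hypothesis modC : forall n : nat, n \in moduli C ->
  N < n%:R /\ n%:R <= K * N /\ (moduli C n)%:R <= s.

(** [Lam] bounds [- ln alpha(C)], and [eta] bounds the total density of the [Q]-smooth moduli. *)
Let Lam := (1 + 2 / N) * (s * (N^-1 + ln K)).
Let eta := s * (N `^ (- sigma) * expR (8 * sigma * Q `^ sigma * ln Q) * (1 + ln K)).

Let N0 : 0 < N. Proof. exact: lt_le_trans N2. Qed.
Let Q0 : 0 < Q. Proof. exact: lt_le_trans Q2. Qed.
Let s0 : 0 <= s. Proof. exact: le_trans s1. Qed.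
Let KN : N <= K * N. Proof. by rewrite ler_peMl// ltW. Qed.

Let Z := (Num.trunc (K * N)).
Let P : pred nat := fun n => (N < n%:R) && (n%:R <= K * N).

Let modZ n : n \in moduli C -> [/\ P n, (0 < n < Z.+1)%N & (moduli C n)%:R <= s].
Proof.
move=> /modC[Nn [nK ns]]; rewrite /P Nn nK ltnS truncn_ge_nat ?nK ?andbT.
  by split=> //; rewrite -(ltr0n R) (lt_trans N0).
by rewrite (le_trans _ KN)// ltW.
Qed.

Let modN c : c \in (C : seq _) -> N < c.1%:R.
Proof.
move=> cC; have [] // := modC (n := c.1).
rewrite (perm_mem (perm_eq_seq_mset _)); exact: map_f.
Qed.

Lemma sum_inv_moduli_le : \sum_(c <- C) c.1%:R^-1 <= s * (N^-1 + ln K).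
Proof.
apply: le_trans (sum_moduli_le s0 (F := fun n => n%:R^-1) _ modZ) _.
  by move=> n; rewrite invr_ge0.
rewrite ler_wpM2l//.
have E : K * N / N = K by rewrite mulfK// gt_eqF.
rewrite -[in ln K]E.
apply: sum_inv_le => //; last by rewrite invr_ge0 ltW.
by move=> n n0 Nn; rewrite lef_pV2 ?posrE ?ltr0n// ltW.
Qed.

Lemma density_product_moduli_ge : expR (- Lam) <= density_product R C.
Proof.
apply: le_trans (density_product_ge N2 _); last by move=> c /modN/ltW.
rewrite ler_expR lerN2 ler_wpM2l ?sum_inv_moduli_le//.
by rewrite addr_ge0// divr_ge0// ltW.
Qed.

Lemma sum_gcd_moduli_le :
  \sum_(c <- C) \sum_(d <- C) (gcdn c.1 d.1)%:R / (c.1%:R * d.1%:R) <=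
  s ^+ 2 * (2 + ln (K * N)) ^+ 3.
Proof.
have g0 n m : 0 <= (gcdn n m)%:R / (n%:R * m%:R) :> R by rewrite divr_ge0.
have Z0 : (0 < Z)%N by rewrite truncn_gt0 (le_trans _ KN)// (le_trans _ N2)// ler1n.
apply: (@le_trans _ _ (\sum_(c <- C) s * \sum_(1 <= m < Z.+1 | P m)
    (gcdn c.1 m)%:R / (c.1%:R * m%:R))).
  by apply: ler_sum => c _; apply: sum_moduli_le.
rewrite -mulr_sumr expr2 -mulrA ler_wpM2l//.
apply: le_trans (sum_moduli_le s0 (F := fun n => \sum_(1 <= m < Z.+1 | P m)
    (gcdn n m)%:R / (n%:R * m%:R)) _ modZ) _.
  by move=> n; rewrite sumr_ge0.
rewrite ler_wpM2l//; apply: (@le_trans _ _ ((\sum_(1 <= n < Z.+1) n%:R^-1) ^+ 3)).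
  apply: le_trans (sum_gcd_le Z).
  rewrite big_mkcond; apply: ler_sum => n _; case: ifP => _; last by rewrite sumr_ge0.
  by rewrite big_mkcond; apply: ler_sum => m _; case: ifP.
have H0 : 0 <= \sum_(1 <= n < Z.+1) n%:R^-1 :> R.
  by apply: sumr_ge0 => n _; rewrite invr_ge0.
have HK : \sum_(1 <= n < Z.+1) n%:R^-1 <= 2 + ln (K * N).
  have KN0 : 0 < K * N := lt_le_trans N0 KN.
  apply: le_trans (harmonic_le Z0) _; rewrite lerD2l ler_ln ?posrE ?ltr0n//.
  by rewrite truncn_le ltW.
by rewrite lerXn2r ?nnegrE// (le_trans H0).
Qed.

(** [avoids_ge_smooth] is applied with [- ln alpha(C)] in place of its [Lam], so that its leading
    factor is exactly [alpha(C)]. *)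
Lemma delta_ge :
  alpha R C * (1 - eta - Lam * (eta + 2 / Q) -
     s ^+ 2 * (2 + ln (K * N)) ^+ 3 * expR Lam / Q) <= delta R C.
Proof.
pose k := Num.trunc Q; pose pi : nat_pred := [pred p | (p < k.+1)%N].
pose T := (\prod_(c <- C) c.1)%N.
have C0 c : c \in (C : seq _) -> (0 < c.1)%N.
  by move=> /modN Nc; rewrite -(ltr0n R) (lt_trans N0).
have T0 : (0 < T)%N.
  by rewrite /T big_seq prodn_cond_gt0// => c /C0.
have CT : common_multiple T C.
  by apply/allP => c cC; rewrite /T (big_rem c)//= dvdn_mulr.
have a0 : 0 < alpha R C.
  by rewrite alphaE; apply: lt_le_trans density_product_moduli_ge; rewrite expR_gt0.
have aLam : expR (- Lam) <= alpha R C by rewrite alphaE density_product_moduli_ge.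
have aL : ln (alpha R C) >= - Lam by rewrite -ler_expR lnK ?posrE.
have k0 : (0 < k)%N by rewrite truncn_gt0 (le_trans _ Q2)// ler1n.
have kQ : k%:R <= Q by rewrite truncn_le ltW.
have rough p : prime p -> p \notin pi -> Q <= p%:R.
  move=> _; rewrite inE -leqNgt => kp; rewrite ltW// (lt_le_trans (truncnS_gt Q))//.
  by rewrite ler_nat.
have lnK0 : 0 <= ln K by rewrite ln_ge0.
have N0' := ltW N0.
have eta0 : 0 <= eta by rewrite /eta !mulr_ge0 ?powR_ge0 ?expR_ge0// addr_ge0.
(* Apply [1 - t <= exp (- t)] to every factor of [alpha(C)]. *)
have Slam : \sum_(c <- C) c.1%:R^-1 <= - ln (alpha R C).
  rewrite -lerN2 opprK -ler_expR lnK ?posrE// alphaE /density_product.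
  rewrite -sumrN expR_sum big_seq [leRHS]big_seq.
  apply: ler_prod => c cC; apply/andP; split.
    rewrite subr_ge0 invf_le1 ?ltr0n ?C0// ler1n C0//.
  exact: expR_ge1Dx.
have Seta : \sum_(c <- C | (c.1`_pi^' == 1)%N) c.1%:R^-1 <= eta.
  rewrite big_mkcond.
  pose F n : R := if (n`_pi^' == 1)%N then n%:R^-1 else 0.
  have F0 n : 0 <= F n by rewrite /F; case: ifP; rewrite ?invr_ge0.
  apply: le_trans (sum_moduli_le s0 F0 modZ) _.
  rewrite /eta ler_wpM2l// /F -big_mkcondr.
  have kW : k%:R `^ sigma <= Q `^ sigma by rewrite ge0_ler_powR// ?nnegrE// ltW.
  have Q1 : 0 < k%:R :> R by rewrite ltr0n.
  have := sum_smooth_le sigma0 sigma1 K1 Z k0 N0 kW.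
  under [leLHS]eq_bigl => n do rewrite andbA.
  move/le_trans; apply; rewrite ler_wpM2r ?addr_ge0//.
  rewrite ler_wpM2l ?powR_ge0// ler_expR ler_wpM2l//.
    by rewrite !mulr_ge0// powR_ge0.
  by rewrite ler_ln ?posrE.
rewrite (deltaE R T0 CT).
apply: le_trans (avoids_ge_smooth Q2 rough T0 CT Slam Seta).
rewrite opprK lnK ?posrE// mulrBr lerB//.
  rewrite ler_pM2l// lerB// ler_wpM2r//; last by rewrite lerNl.
  by rewrite addr_ge0// divr_ge0// ltW.
(* This turns the additive error from the pairs into a multiple of [alpha(C)]. *)
have e1 : 1 <= alpha R C * expR Lam.
  by rewrite -[expR Lam]invrK -expRN ler_pdivlMr ?expR_gt0// mul1r.
rewrite mulrA [leRHS]mulrC ler_pM2l ?invr_gt0//.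
apply: le_trans sum_gcd_moduli_le _.
rewrite [leRHS]mulrCA ler_peMr//.
rewrite mulr_ge0// exprn_ge0// addr_ge0// ln_ge0// (le_trans _ KN)//.
by rewrite (le_trans _ N2)// ler1n.
Qed.
End Bound.
End Assembly.

(** * Asymptotics *)

Section Asymptotics.
Variable R : realType.

Lemma expR_ge_sqr (x : R) : 0 <= x -> x ^+ 2 / 2 <= expR x.
Proof.
by move=> x0; apply: le_trans (expR_ge1Dxn 1 x0); rewrite lerDr.
Qed.

(** In the application [l] is [ln N] and [X] is [ln (s * ln N)]; [Xb] then expresses the upper bound
    on [s]. *)
Variables (T e b l X : R).
(* [T] is kept abstract because computing with the numeral 1152 is very slow;
   its value makes [expR (ln l) >= (ln l) ^+ 2 / 2] yield [lnl_le] below. *)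
Hypothesis TE : T = 24 ^+ 2 * 2.
Hypotheses (e0 : 0 < e) (e1 : e <= 1 / 4) (b0 : 0 < b) (b1 : b <= 1).
Hypotheses (la : expR (T / e ^+ 3) <= ln l) (l0 : 0 < l).
Hypotheses (aX : ln l <= X) (Xb : X <= b * Num.sqrt (l * ln l) + ln l).

Let T_ge : 16 <= T. Proof. by rewrite TE; lra. Qed.

Let T_ge0 : 0 <= T. Proof. exact: le_trans T_ge. Qed.

Let tau := T / e ^+ 3.

Let tau_ge : T <= tau.
Proof.
have e30 : 0 < e ^+ 3 by rewrite exprn_gt0.
rewrite /tau ler_pdivlMr// ler_piMr//.
by rewrite exprn_ile1//; move: e0 e1; lra.
Qed.

Lemma lnl_ge : T <= ln l.
Proof.
apply: le_trans la; apply: le_trans (expR_ge1Dx _); move: T_ge tau_ge; rewrite /tau; lra.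
Qed.

Lemma lnX_ge : T / e ^+ 3 <= ln X.
Proof.
have X0 : 0 < X by move: T_ge lnl_ge aX; lra.
by rewrite -ler_expR (lnK X0) (le_trans la).
Qed.

(** Serves to bound the exponent [8 * sigma * Q^sigma * ln Q] by [e * X]. It follows from
    [exp y >= y^2 / 2] at [y = e * ln X], because [e^3 * ln X >= T >= 16]. *)
Lemma smooth_exponent_le : 8 * ln X <= e * expR (e * ln X).
Proof.
have t1 := lnX_ge; have e30 : 0 < e ^+ 3 by rewrite exprn_gt0.
move: t1; rewrite ler_pdivrMr// => t1.
have t0 : 0 <= ln X by move: T_ge tau_ge lnX_ge; rewrite /tau; lra.
have et0 : 0 <= e * ln X by rewrite mulr_ge0// ltW.
apply: (@le_trans _ _ (e * ((e * ln X) ^+ 2 / 2))); last by rewrite ler_pM2l// expR_ge_sqr.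
have -> : e * ((e * ln X) ^+ 2 / 2) = (ln X * e ^+ 3) / 2 * ln X by field.
by rewrite ler_wpM2r//; move: t1 T_ge; lra.
Qed.

Let r := Num.sqrt (l * ln l).

Let r2 : r ^+ 2 = l * ln l.
Proof. by rewrite sqr_sqrtr// mulr_ge0// ?ltW//; move: T_ge lnl_ge; lra. Qed.

Let r0 : 0 <= r. Proof. exact: sqrtr_ge0. Qed.

Let el : expR (ln l) = l. Proof. by rewrite lnK. Qed.

Let lnl_le : ln l <= (e / 24) ^+ 2 * l.
Proof.
have T12 := T_ge; have a1 := lnl_ge; set a := ln l in a1 *.
have al : a ^+ 2 / 2 <= l by rewrite -el expR_ge_sqr// -/a; lra.
have : T / e ^+ 3 <= a by rewrite (le_trans _ la)// (le_trans _ (expR_ge1Dx _))// lerDr.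
rewrite ler_pdivrMr ?exprn_gt0// => ae.
have ae2 : T <= a * e ^+ 2.
  apply: le_trans ae _; rewrite ler_wpM2l//; first by lra.
  by rewrite exprS ler_piMl ?sqr_ge0//; move: e1; lra.
apply: (@le_trans _ _ ((e / 24) ^+ 2 * (a ^+ 2 / 2))); last first.
  by rewrite ler_wpM2l// sqr_ge0.
have -> : (e / 24) ^+ 2 * (a ^+ 2 / 2) = (a * e ^+ 2) / T * a by rewrite TE; field.
have T0 : 0 < T by lra.
by rewrite ler_peMl ?ler_pdivlMr ?mul1r//; lra.
Qed.

Let r_le : r <= e / 24 * l.
Proof.
have el0 : 0 <= e / 24 * l by rewrite mulr_ge0 ?divr_ge0 ?ltW.
rewrite -(@ler_pXn2r _ 2) ?nnegrE// r2 exprMn [l ^+ 2]expr2 mulrA mulrC.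
by rewrite ler_wpM2r// ltW.
Qed.

Let lnl_le_r : ln l <= r.
Proof.
have a0 : 0 <= ln l by move: T_ge lnl_ge; lra.
rewrite -(@ler_pXn2r _ 2) ?nnegrE// r2 expr2 ler_wpM2r// ltW//.
exact: ln_sublinear.
Qed.

(** Used for [sigma <= 1 / 2] and [s <= N]. Here [X] is at most [2 * r], and [r] is small against
    [l]. *)
Lemma X_le : 8 * X <= l.
Proof.
have : b * r <= r by rewrite ler_piMl.
have el4 : e / 24 * l <= 1 / 96 * l by rewrite ler_wpM2r ?(ltW l0)//; move: e1; lra.
by move: Xb r_le lnl_le_r el4 l0; rewrite -/r; lra.
Qed.

(* With [X = ln (s * ln N)] this compares [s ^ 2] with a power of [L N s]. *)
Lemma L_exponent_ge : 2 * X + 3 * ln l <= (e + 4 * b ^+ 2) * (l * (ln X / X)).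
Proof.
have T12 := T_ge; have a1 := lnl_ge; have X0 : 0 < X by move: T_ge lnl_ge aX; lra.
have aX' := aX; have l0' := l0; have e0' := e0; have b0' := b0.
have tg := lnX_ge.
have -> : (e + 4 * b ^+ 2) * (l * (ln X / X)) = (e + 4 * b ^+ 2) * l * ln X / X.
  by field; rewrite gt_eqF.
rewrite ler_pdivlMr//.
have b20 : 0 <= b ^+ 2 by rewrite sqr_ge0.
have t0 : 0 <= ln X by move: T_ge tau_ge lnX_ge; rewrite /tau; lra.
(* For [X >= sqrt l] one has [ln X >= ln l / 2]. After multiplication by [X], the leading part of
   [2 * X^2] is [2 * b^2 * l * ln l], which the [4 * b^2] on the right pays for exactly; the [e]
   absorbs the rest. *)
have [Xs|Xs] := lerP (Num.sqrt l) X.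
  have th : ln l / 2 <= ln X.
    have -> : ln l / 2 = ln (Num.sqrt l).
      have {1}<- : Num.sqrt l ^+ 2 = l by rewrite sqr_sqrtr// ltW.
      by rewrite lnXn ?sqrtr_gt0// -mulr_natr; field.
    by rewrite ler_ln ?posrE// sqrtr_gt0.
  apply: (@le_trans _ _ ((e + 4 * b ^+ 2) * l * (ln l / 2))); last first.
    by rewrite ler_wpM2l// mulr_ge0 ?addr_ge0 ?mulr_ge0// ltW.
  move: r_le lnl_le_r r2 r0 Xb; rewrite -/r; set a := ln l in a1 aX' *.
  move=> rl ar rr rp XB.
  have h1 : X ^+ 2 <= (b * r + a) ^+ 2.
    rewrite lerXn2r ?nnegrE//; last by rewrite addr_ge0 ?mulr_ge0//; lra.
    exact: ltW.
  have h2 : X * a <= (b * r + a) * a by rewrite ler_wpM2r//; lra.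
  have br : b * r <= r by rewrite ler_piMl.
  have h3 : (b * r + a) ^+ 2 = b ^+ 2 * (l * a) + 2 * (b * r) * a + a * a.
    by rewrite -rr; ring.
  have h4 : (b * r) * a <= r * a by rewrite ler_wpM2r//; lra.
  have h5 : a * a <= r * a by rewrite ler_wpM2r//; lra.
  have h6 : r * a <= e / 24 * l * a by rewrite ler_wpM2r//; lra.
  have -> : (2 * X + 3 * a) * X = 2 * X ^+ 2 + 3 * (X * a) by ring.
  have -> : (e + 4 * b ^+ 2) * l * (a / 2) =
    12 * (e / 24 * l * a) + 2 * (b ^+ 2 * (l * a)) by field.
  rewrite h3 in h1; lra.
(* For [X < sqrt l] the left side times [X] is at most [5 * X^2 <= 5 * l], and [e * ln X >= 5]. *)
have sl : Num.sqrt l ^+ 2 = l by rewrite sqr_sqrtr// ltW.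
have X2 : X ^+ 2 <= l by rewrite -sl lerXn2r ?nnegrE// ?ltW.
have aX2 : ln l * X <= X ^+ 2 by rewrite expr2 ler_wpM2r// ltW.
have et : 5 <= e * ln X.
  apply: (@le_trans _ _ (e * (T / e ^+ 3))); last by rewrite ler_pM2l.
  have -> : e * (T / e ^+ 3) = T / e ^+ 2 by field; rewrite gt_eqF.
  have e2 : 0 < e ^+ 2 by rewrite exprn_gt0.
  by rewrite ler_pdivlMr// (@le_trans _ _ 5)//; [rewrite ler_piMr// exprn_ile1//; move: e0 e1|]; lra.
apply: (@le_trans _ _ (5 * l)).
  by rewrite mulrDl -mulrA -expr2 -mulrA; lra.
rewrite [leRHS]mulrAC ler_pM2r//.
apply: le_trans et _; rewrite ler_wpM2r//; lra.
Qed.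
End Asymptotics.

(** * Choice of the parameters for large N *)

(** The margin [eps = 2 * e + 4 * b^2] is split: one [e] lowers the exponent of [Q] below [1 / 2],
    and [e + 4 * b^2] remains to absorb [s^2] and the powers of [ln N] in the pair term. *)
Lemma delta_ge_large (R : realType) (T e b eps N s : R) (C : {fset nat * nat}) :
  T = 24 ^+ 2 * 2 -> 0 < e -> e <= 1 / 4 -> 0 < b -> b <= 1 ->
  eps = 2 * e + 4 * b ^+ 2 -> eps < 1 / 2 ->
  1 < N -> expR (T / e ^+ 3) <= ln (ln N) ->
  1 <= s -> s <= expR (b * Num.sqrt (ln N * ln (ln N))) ->
  let K := L N s `^ ((1 / 2 - eps) / s) in
  (forall n : nat, n \in moduli C ->
     N < n%:R /\ n%:R <= K * N /\ (moduli C n)%:R <= s) ->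
  (1 - (6 + 27 * expR 3) / ln N `^ e) * alpha R C <= delta R C.
Proof.
move=> TE e0 e4 b0 b1 epsE eps2 N1 Nlarge s1 sb K modC.
set l := ln N in Nlarge sb *; set a := ln l in Nlarge sb.
pose S := ln s; pose X := S + a.
have l0 : 0 < l by rewrite ln_gt0.
have N0 : 0 < N by lra.
have s0 : 0 < s by lra.
have El : expR a = l by rewrite lnK.
have EN : expR l = N by rewrite lnK.
have Es : expR S = s by rewrite lnK.
have S0 : 0 <= S by rewrite ln_ge0.
have XE : ln (s * ln N) = X by rewrite lnM ?posrE.
have aX : a <= X by rewrite /X; lra.
have Xb : X <= b * Num.sqrt (l * a) + a by rewrite lerD2r -ler_expR Es.
have a1 : 16 <= a.
  by apply: le_trans (lnl_ge TE e0 e4 Nlarge); rewrite TE; lra.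
have X8 := X_le TE e0 e4 b1 Nlarge l0 Xb.
have tX := smooth_exponent_le TE e0 e4 Nlarge aX.
have LX := L_exponent_ge TE e0 e4 b0 b1 Nlarge l0 aX Xb; rewrite -/a in LX.
set Lm := l * (ln X / X) in LX.
clear T TE Nlarge Xb sb.
have X0 : 0 < X by lra.
have t0 : 0 <= ln X by rewrite ln_ge0//; lra.
have Lm0 : 0 <= Lm by rewrite mulr_ge0 ?divr_ge0// ltW.
have Lml : Lm <= l.
  by rewrite ler_piMr ?(ltW l0)// ler_pdivrMr// mul1r ltW// ln_sublinear.
have LE : L N s = expR Lm by rewrite /L XE.
(* The [1 / s] in the exponent of [K] cancels the multiplicity [s]. *)
have sK : s * ln K = (1 / 2 - eps) * Lm.
  by rewrite /K ln_powR LE expRK; field; rewrite gt_eqF.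
have K0 : 0 < K by rewrite powR_gt0// LE expR_gt0.
have lnK0 : 0 <= ln K.
  by rewrite -(pmulr_rge0 _ s0) sK mulr_ge0//; lra.
have K1 : 1 <= K by rewrite -(lnK (x := K)) ?posrE// -expR0 ler_expR.
have lN : l < N by exact: ln_sublinear.
have la : a < l by exact: ln_sublinear.
(* [Q = exp Y] is [L(N, s)^(1/2 - e)]. The choice of [sigma] makes [N^(- sigma)] equal to
   [exp (- (2 + 2 e) X)], while [sigma * Y = (1 + e) (1 - 2 e) ln X] gives
   [Q^sigma <= X^(1 - e)]. *)
pose Y := (1 / 2 - e) * Lm; pose sigma := (2 + 2 * e) * X / l.
have sigma0 : 0 <= sigma by rewrite divr_ge0 ?mulr_ge0// ?ltW//; lra.
have sigma1 : sigma <= 1 / 2.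
  have : e * X <= 1 / 4 * X by rewrite ler_wpM2r// ltW.
  by rewrite ler_pdivrMr//; lra.
have b20 : 0 <= b ^+ 2 by rewrite sqr_ge0.
have epsLm : 0 <= eps * Lm by rewrite mulr_ge0//; lra.
have Y2 : 2 * a <= Y.
  have : (e + 4 * b ^+ 2) * Lm <= (1 / 2 - e) * Lm by rewrite ler_wpM2r//; lra.
  by rewrite /Y; lra.
have Q2 : 2 <= expR Y by apply: le_trans (expR_ge1Dx _); lra.
have N2 : 2 <= N by lra.
have := delta_ge N2 s1 K1 Q2 sigma0 sigma1 modC.
set Lam := (1 + 2 / N) * _; set eta := s * _.
have sN : s / N <= 1 by rewrite ler_pdivrMr// mul1r -Es -EN ler_expR; rewrite /X in X8 aX; lra.
(* Expanding the product leaves three error terms, each at most 1. *)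
have LamU : Lam <= 3 + (1 / 2 - eps) * Lm.
  have -> : Lam = (1 + 2 / N) * (s / N + (1 / 2 - eps) * Lm) by rewrite /Lam mulrDr sK.
  have N2' : 2 / N <= 1 by rewrite ler_pdivrMr//; lra.
  have h1 : 2 / N * (s / N) <= 1 * 1.
    by rewrite ler_pM// divr_ge0// ltW.
  have h2 : 2 / N * ((1 / 2 - eps) * Lm) <= 1.
    by rewrite mulrAC ler_pdivrMr//; lra.
  lra.
have Lam_l : Lam <= l by lra.
have lnKs : ln K <= s * ln K by rewrite ler_peMl.
(* Powers of [exp X = s * ln N]: [- (2 + 2 e)] from [N^(- sigma)], [e] from the Rankin exponential,
   and 1 from [s * (1 + ln K)]. *)
have etaU : eta <= 2 * expR (- (1 + e) * X).
  have -> : eta = N `^ (- sigma) * expR (8 * sigma * expR Y `^ sigma * ln (expR Y)) *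
     (s + s * ln K) by rewrite /eta; ring.
  have -> : N `^ (- sigma) = expR (- (2 + 2 * e) * X).
    by rewrite /powR gt_eqF// -/l /sigma; congr expR; field; rewrite gt_eqF.
  have sY : sigma * Y <= (1 - e) * ln X.
    have -> : sigma * Y = (1 + e) * (1 - 2 * e) * ln X.
      by rewrite /sigma /Y /Lm; field; rewrite !gt_eqF.
    by rewrite ler_wpM2r//; have := sqr_ge0 e; lra.
  have sY0 : 0 <= sigma * Y by rewrite mulr_ge0//; lra.
  have h1 : expR (8 * sigma * expR Y `^ sigma * ln (expR Y)) <= expR (e * X).
    rewrite ler_expR -expRM expRK [Y * sigma]mulrC.
    apply: (@le_trans _ _ (8 * ln X * expR ((1 - e) * ln X))).
      have -> : 8 * sigma * expR (sigma * Y) * Y = 8 * (sigma * Y) * expR (sigma * Y) by ring.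
      have et0 : 0 <= e * ln X by rewrite mulr_ge0// ltW.
      by apply: ler_pM; rewrite ?expR_ge0 ?ler_expR//; lra.
    apply: (@le_trans _ _ (e * expR (e * ln X) * expR ((1 - e) * ln X))).
      by rewrite ler_wpM2r ?expR_ge0.
    rewrite -mulrA -expRD -mulrDl.
    have -> : e + (1 - e) = 1 by ring.
    by rewrite mul1r lnK.
  have h2 : s + s * ln K <= 2 * expR X.
    have -> : expR X = s * l by rewrite expRD Es El.
    have : s <= s * l by rewrite ler_peMr//; lra.
    have : l <= s * l by rewrite ler_peMl//; lra.
    by rewrite sK; lra.
  have -> : 2 * expR (- (1 + e) * X) =
     expR (- (2 + 2 * e) * X) * expR (e * X) * (2 * expR X).
    by rewrite [RHS]mulrCA -!expRD; congr (_ * expR _); ring.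
  rewrite ler_pM ?mulr_ge0 ?expR_ge0// ?addr_ge0 ?mulr_ge0 ?(ltW s0)//.
  by rewrite ler_wpM2l ?expR_ge0.
pose p := expR (- e * a).
have pE : (l `^ e)^-1 = p by rewrite /powR gt_eqF// -expRN /p mulNr.
have eta0 : 0 <= eta.
  by rewrite /eta !mulr_ge0 ?powR_ge0 ?expR_ge0 ?addr_ge0 ?(ltW s0).
(* Since [exp X >= l], the saving [exp (- X)] pays for the factor [l], which is at least [Lam]. *)
have leta : l * eta <= 2 * p.
  apply: (@le_trans _ _ (l * (2 * expR (- (1 + e) * X)))).
    by rewrite ler_wpM2l// ltW.
  rewrite mulrCA ler_wpM2l// -El -expRD ler_expR.
  have : e * a <= e * X by rewrite ler_wpM2l// ltW.
  by lra.
have eta_le : eta <= l * eta by rewrite ler_peMl//; lra.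
have Lam0 : 0 <= Lam.
  by rewrite /Lam mulr_ge0 ?addr_ge0 ?divr_ge0 ?mulr_ge0 ?addr_ge0 ?invr_ge0 ?(ltW s0) ?(ltW N0).
have ea : e * a <= a by rewrite ler_piMl//; lra.
have Lam_eta : Lam * eta <= 2 * p.
  by apply: le_trans leta; rewrite ler_wpM2r.
have LamQ : Lam * (2 / expR Y) <= 2 * p.
  apply: (@le_trans _ _ (l * (2 / expR Y))).
    by rewrite ler_wpM2r// divr_ge0 ?expR_ge0.
  by rewrite mulrCA ler_wpM2l// -El -expRN -expRD ler_expR; lra.
(* The 27 is [3^3], from [2 + ln (K * N) <= 3 * l], and [expR 3] comes from [LamU]; [LX] pays for
   [s^2 * l^3]. *)
have pairs : s ^+ 2 * (2 + ln (K * N)) ^+ 3 * expR Lam / expR Y <= 27 * expR 3 * p.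
  have KN : 2 + ln (K * N) <= 3 * l.
    by rewrite lnM ?posrE// -/l; lra.
  have KN0 : 0 <= 2 + ln (K * N) by rewrite lnM ?posrE// -/l; lra.
  apply: (@le_trans _ _ (s ^+ 2 * (3 * l) ^+ 3 *
      expR (3 + (1 / 2 - eps) * Lm) / expR Y)).
    rewrite ler_wpM2r ?invr_ge0 ?expR_ge0//.
    apply: ler_pM; rewrite ?expR_ge0 ?ler_expR//.
      by rewrite mulr_ge0 ?sqr_ge0 ?exprn_ge0.
    by rewrite ler_wpM2l ?sqr_ge0// lerXn2r ?nnegrE// (le_trans KN0).
  have -> : s ^+ 2 * (3 * l) ^+ 3 * expR (3 + (1 / 2 - eps) * Lm) / expR Y =
     27 * expR 3 * (s ^+ 2 * l ^+ 3 * expR ((1 / 2 - eps) * Lm - Y)).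
    by rewrite expRD expRB; field; rewrite gt_eqF ?expR_gt0.
  rewrite ler_wpM2l ?mulr_ge0 ?expR_ge0//.
  rewrite -Es -El -!expRM_natl -!expRD ler_expR /Y epsE.
  by move: LX; rewrite /X; lra.
have al0 : 0 <= alpha R C.
  rewrite alphaE; apply: density_product_ge0 => c cC.
  have [] // : N < c.1%:R /\ c.1%:R <= K * N /\ (moduli C c.1)%:R <= s.
    by apply: modC; rewrite (perm_mem (perm_eq_seq_mset _)); exact: map_f.
  by rewrite -(ltr0n R) => /(lt_trans N0).
apply: le_trans; rewrite mulrC; apply: ler_wpM2l => //.
(* Three errors of [2 * p] and the pair term add up to the stated constant times [p]. *)
by rewrite pE mulrDr; lra.
Qed.

(** * Small N and the final constants *)

Lemma delta_ge0 (R : realType) (C : {fset nat * nat}) : residue_system C -> 0 <= delta R C.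
Proof.
move=> C0; rewrite (deltaE R (T := (\prod_(c <- C) c.1)%N)).
- exact: mean_ge0.
- by rewrite big_seq prodn_cond_gt0// => -[n r] /C0[].
- by apply/allP => c cC; rewrite (big_rem c)//= dvdn_mulr.
Qed.

Lemma alpha_ge0 (R : realType) (C : {fset nat * nat}) : residue_system C -> 0 <= alpha R C.
Proof.
by move=> C0; rewrite alphaE; apply: density_product_ge0 => -[n r] /C0[].
Qed.

Theorem theorem4 (R : realType) :
  exists A : R, 0 < A /\
  forall eps b : R,
    0 < eps -> eps < 1 / 2 -> 0 < b -> b < 1 / 2 * Num.sqrt eps ->
  exists lambda : R, 0 < lambda /\
  forall N s : R,
    100 <= N -> 1 <= s -> s <= expR (b * Num.sqrt (ln N * ln (ln N))) ->
  let K := L N s `^ ((1 / 2 - eps) / s) in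
  forall C : {fset nat * nat},
    residue_system C ->
    (forall n : nat, n \in moduli C ->
       N < n%:R /\ n%:R <= K * N /\ (moduli C n)%:R <= s) ->
  (1 - A / ln N `^ lambda) * alpha R C <= delta R C.
Proof.
have e3 := expR_gt0 (3 : R).
exists (6 + 27 * expR 3); split; first by lra.
move=> eps b eps0 eps2 b0 beps.
have b2 : 4 * b ^+ 2 < eps.
  have : b ^+ 2 < (1 / 2 * Num.sqrt eps) ^+ 2.
    by rewrite ltrXn2r// ?nnegrE ltW.
  by rewrite exprMn sqr_sqrtr ?(ltW eps0)//; lra.
have b20 : 0 <= b ^+ 2 by rewrite sqr_ge0.
(* Half of the gap between [eps] and [4 * b^2], positive because [b < sqrt eps / 2]. *)
pose e := (eps - 4 * b ^+ 2) / 2.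
have e0 : 0 < e by rewrite /e; lra.
have e4 : e <= 1 / 4 by rewrite /e; lra.
have epsE : eps = 2 * e + 4 * b ^+ 2 by rewrite /e; field.
have b1 : b <= 1.
  by rewrite -(@ler_pXn2r _ 2) ?nnegrE ?(ltW b0)// expr1n; lra.
pose T : R := 24 ^+ 2 * 2.
pose tau := expR (T / e ^+ 3).
have tau0 : 0 < tau by rewrite expR_gt0.
(* For [ln (ln N) < tau], having [lambda <= 1 / tau] gives [(ln N)^lambda <= exp 1], which is below
   the absolute constant; the claimed lower bound is then at most 0. *)
exists (Num.min e tau^-1); split; first by rewrite lt_min e0 invr_gt0.
move=> N s N100 s1 sb K C resC modC.
have N1 : 1 < N by lra.
have l0 : 0 < ln N by rewrite ln_gt0.
set lambda := Num.min _ _.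
have lam0 : 0 <= lambda by rewrite le_min !ltW ?invr_gt0.
have [Nlarge|Nsmall] := lerP tau (ln (ln N)).
  apply: le_trans (delta_ge_large (T := T) _ e0 e4 b0 b1 epsE eps2 N1 Nlarge s1 sb modC) => //.
  apply: ler_wpM2r; first exact: alpha_ge0.
  rewrite lerD2l lerN2 ler_wpM2l//.
  rewrite lef_pV2 ?posrE ?powR_gt0// ler_powR ?ge_min ?lexx//.
  rewrite -[leRHS](lnK (x := ln N)) ?posrE// -[leLHS]expR0 ler_expR ltW//.
  exact: lt_le_trans Nlarge.
apply: le_trans (delta_ge0 R resC).
rewrite mulr_le0_ge0 ?alpha_ge0// subr_le0 ler_pdivlMr ?powR_gt0// mul1r.
apply: (@le_trans _ _ (expR 1)).
  rewrite /powR gt_eqF// ler_expR.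
  apply: (@le_trans _ _ (lambda * tau)); first by rewrite ler_wpM2l// ltW.
  by rewrite -ler_pdivlMr// mul1r ge_min lexx orbT.
have : expR 1 <= expR (3 : R) by rewrite ler_expR; lra.
lra.
Qed.
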